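(* Let $m\ge 5$ and let $G\in\mathscr{U}_{n,m}\setminus\{U_{n,m}\}$, i.e. $G$ is an $n$-vertex unicyclic graph with matching number $m$ that is not isomorphic to $U_{n,m}$. Then $\xi^d(G)\ge 6n^2+m^2+9mn-28m-22n-4$, with equality if and only if $G\cong U_{n,m}'$.
   Context: All graphs are finite, simple and connected. For a graph $G$ and $v\in V_G$, $d(u,v)$ is the usual graph distance, $\varepsilon_G(v)=\max_{u\in V_G} d(u,v)$ is the eccentricity, and $D_G(v)=\sum_{u\in V_G} d(u,v)$. The eccentric distance sum is $\xi^d(G)=\sum_{v\in V_G}\varepsilon_G(v)D_G(v)$. A unicyclic graph is a connected graph with $|V_G|=|E_G|$. The matching number is the maximum number of pairwise independent edges. $\mathscr{U}_{n,m}$ is the set of unicyclic graphs with $n$ vertices and matching number $m$ (so $m\le\lfloor n/2\rfloor$). $U_{n,m}$ is the $n$-vertex graph obtained from a triangle $C_3=u_1u_2u_3u_1$ by attaching $n-2m+1$ pendant vertices and $m-2$ pendant paths of length $2$ (each by identifying one of its end vertices with $u_1$) to the single vertex $u_1$. $U_{n,m}'$ (for $m\ge 3$) is the $n$-vertex graph obtained from a cycle $C_5=u_1u_2u_3u_4u_5u_1$ by attaching $n-2m+1$ pendant vertices and $m-3$ pendant paths of length $2$ (each by identifying one of its end vertices with $u_2$) to the single vertex $u_2$. *)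

(* Defs.v *)
From HB Require Import structures.
From mathcomp Require Import all_boot all_order all_algebra.

Set Implicit Arguments.
Unset Strict Implicit.
Unset Printing Implicit Defensive.

Record sgraph := SGraph {
  vertex :> finType;
  adj : rel vertex;
  adj_sym : symmetric adj;
  adj_irrefl : irreflexive adj }.

Definition connected (G : sgraph) : Prop :=
  forall x y : G, connect (@adj G) x y.

Definition isomorphic (G H : sgraph) : Prop :=
  exists2 f : G -> H, bijective f & forall x y : G, adj (f x) (f y) = adj x y.

Definition edges (G : sgraph) : {set {set G}} :=
  [set [set x; y] | x in G, y in G & adj x y].

(* The least length of a walk from x to y; it is the junk value #|G| when there
   is no walk of length less than #|G|, i.e. when x and y are not connected. *)
Definition dist (G : sgraph) (x y : G) : nat :=
  find (fun k => [exists p : k.-tuple G, path (@adj G) x p && (last x p == y)])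
       (iota 0 #|G|).

Definition ecc (G : sgraph) (v : G) : nat := \max_(u : G) dist u v.

Definition dist_sum (G : sgraph) (v : G) : nat := \sum_(u : G) dist u v.

Definition ecc_dist_sum (G : sgraph) : nat :=
  \sum_(v : G) ecc v * dist_sum v.

Definition is_matching (G : sgraph) (M : {set {set G}}) : bool :=
  (M \subset edges G) && trivIset M.

Definition matching_number (G : sgraph) : nat :=
  \max_(M : {set {set G}} | is_matching M) #|M|.

Definition unicyclic (G : sgraph) : Prop :=
  connected G /\ #|G| = #|edges G|.

Definition unicyclic_nm (n m : nat) (G : sgraph) : Prop :=
  [/\ unicyclic G, #|G| = n & matching_number G = m].

(* This is the cycle C_k only for k >= 3. *)
Definition cycle_adj (k : nat) : rel 'I_k :=
  fun i j => (i != j) && ((j == ordS i) || (i == ordS j)).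

Lemma cycle_adj_sym k : symmetric (@cycle_adj k).
Proof. by move=> i j; rewrite /cycle_adj eq_sym orbC. Qed.

Lemma cycle_adj_irrefl k : irreflexive (@cycle_adj k).
Proof. by move=> i; rewrite /cycle_adj eqxx. Qed.

Definition cycle_graph (k : nat) : sgraph :=
  SGraph (@cycle_adj_sym k) (@cycle_adj_irrefl k).

Section Attach.
Variables (G : sgraph) (v : G) (a b : nat).

(* G with a pendant vertices and b pendant paths of length 2 attached at v:
   inr (inl i) is the i-th pendant vertex, and the j-th pendant path is
   v -- inr (inr (j, false)) -- inr (inr (j, true)). *)
Definition attach_vertex : finType := (G + ('I_a + 'I_b * bool))%type.

Definition attach_adj : rel attach_vertex := fun x y =>
  match x, y with
  | inl x, inl y => adj x y
  | inl x, inr (inl _) | inr (inl _), inl x => x == v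
  | inl x, inr (inr (_, far)) | inr (inr (_, far)), inl x => (x == v) && ~~ far
  | inr (inr (i, s)), inr (inr (j, t)) => (i == j) && (s != t)
  | _, _ => false
  end.

Lemma attach_adj_sym : symmetric attach_adj.
Proof.
move=> [x|[i|[i s]]] [y|[j|[j t]]] //=; first exact: adj_sym.
by rewrite eq_sym [s == t]eq_sym.
Qed.

Lemma attach_adj_irrefl : irreflexive attach_adj.
Proof. by move=> [x|[i|[i s]]] //=; rewrite ?adj_irrefl ?eqxx ?andbF. Qed.

Definition attach : sgraph := SGraph attach_adj_sym attach_adj_irrefl.

End Attach.

(* Both families are meant for 2 * m <= n, which is automatic when some n-vertex
   graph has matching number m. *)
Definition U_graph (n m : nat) : sgraph :=
  @attach (cycle_graph 3) (ord0 : 'I_3) (n - 2 * m + 1) (m - 2).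

(* All vertices of C_5 being equivalent, ord0 plays the role of u_2. *)
Definition U'_graph (n m : nat) : sgraph :=
  @attach (cycle_graph 5) (ord0 : 'I_5) (n - 2 * m + 1) (m - 3).

(* Main.v *)
(** Write the invariant as the sum over ordered pairs of ecc x * d(x, y).

    If some vertex c has eccentricity at most 2 (it cannot be smaller since
    m >= 5), then G is a spanning tree of depth 2 rooted at c plus one edge ab.
    Vertices at depth l have eccentricity at least 2 + l, and the distance is the
    tree distance minus an explicit saving due to ab, so the sum is bounded below
    by a polynomial in the degree k of c, the number s of vertices at depth 2 and
    the numbers of children of the neighbours of c.  The matching number is at
    most t + 1 or t + 2, where t neighbours of c have children, by exhibiting
    vertex covers.  According to the depths of a and b this gives a strict
    inequality, or G = U_{n,m} (a and b are leaves next to c), or G = U'_{n,m}.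

    If all eccentricities are at least 3, then those of the leaves are at least 4.
    G is a cycle of length g with rooted trees hanging from it; every edge outside
    the cycle is a cut and contributes to the sum according to the sizes of its two
    sides only.  A half-integral vertex cover bounds the matching number by the
    number of non-leaves, and the resulting polynomial inequality is always strict;
    when all trees hang from one vertex of a cycle with g <= 5, eccentricity at
    least 3 also forces a tree of depth 3, hence a more balanced cut. *)

Require Import Defs.
From Stdlib Require ZArith.
From mathcomp Require Import all_boot all_order all_algebra.
From mathcomp Require Import zify.

(** * Polynomial inequalities *)

(** Distances are bounded below by one principle: a function that vanishes at [x] and grows by at
    most one along every edge is at most the distance from [x]. Both the count of separating cuts
    plus the distance on the cycle, and the minimum over the tree walk and the two walks through the
    extra edge, are of this kind. Eccentricities are replaced by weights depending only on the
    position of a vertex. For a tree of depth 2, [m >= 5] and [m <= t + 2] force [t >= 3], so every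
    vertex sees the end of a branch of depth 2 to which the extra edge opens no shortcut. The target
    increases with [m], so upper bounds on the matching number suffice; this is why only covers are
    constructed and no matching is ever exhibited. In the second case a cycle vertex without a leaf
    neighbour receives only half the full value, and this correction is carried along as [r].
    Equality for [U'_{n,m}] is a pair of inequalities: the case analysis gives the lower one,
    explicit walks in the attached pentagon the upper one. *)

Section IntegerInequalities.
Import ZArith.
Local Open Scope Z_scope.

(** Along [a + b = n] the product [(a - 2) * (6 * b - 13)] is concave, so its minimum is at an end
    of the range: [b = 3] gives [5 * (n - 5)] and [a = 3] gives [6 * n - 31]. The first end requires
    [g = 3 = b] and hence [r >= 3]; if [r < 3], the range starts at [b = 4]. *)
Lemma excess_arith (a b n g r z : Z) : 10 <= n -> a + b = n -> 3 <= a -> 3 <= g -> g <= b ->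
  (a - 2) * (6 * b - 13) <= z -> (b = g -> g <= r) ->
  5 * (n - 5) <= z /\ (r < 3 -> 6 * n - 31 <= z).
Proof.
intros n10 ab a3 g3 gb az br.
assert (a = n - b) by lia; subst a.
split.
- assert (0 <= (n - b - 3) * (b - 3)) by nia. nia.
- intros r3; assert (4 <= b) by lia. assert (0 <= (n - b - 3) * (b - 4)) by nia. nia.
Qed.

(** The line [4 * g - 16] is tangent to the parabola [g ^ 2 / 4] at [g = 8]. The target increases
    with [m], so [m] is replaced by an upper bound: [k] if [2 * k <= n], and [n / 2] otherwise. *)
Lemma long_cycle_arith (n m k g d xi : Z) :
  5 <= m -> 2 * m <= n -> m <= k -> k <= n -> 8 <= g -> g <= k -> 4 * g - 16 <= d ->
  d * (7 * n - k - 3 * g) + (n - k) * (8 * n - 8 - k) + (k - g) * (15 * n - 28 - 2 * k) <= xi ->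
  6 * n * n + m * m + 9 * m * n - 28 * m - 22 * n - 4 < xi.
Proof.
intros m5 mn mk kn g8 gk dg H.
assert (H1 : 0 <= (d - (4 * g - 16)) * (7 * n - k - 3 * g)) by (apply Z.mul_nonneg_nonneg; lia).
destruct (Z.le_gt_cases (2 * k) n) as [kn2|nk2].
- assert (B : 6 * n * n + m * m + 9 * m * n - 28 * m - 22 * n - 4 <=
              6 * n * n + k * k + 9 * k * n - 28 * k - 22 * n - 4) by nia.
  remember (n - 2 * k) as h eqn:Eh; remember (k - g) as v eqn:Ev; remember (g - 8) as u eqn:Eu.
  assert (h0 : 0 <= h) by lia; assert (v0 : 0 <= v) by lia; assert (u0 : 0 <= u) by lia.
  assert (n = 2 * k + h) by lia; assert (k = g + v) by lia; assert (g = 8 + u) by lia.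
  clear - H B H1 h0 v0 u0 H0 H2 H3; subst n k g.
  assert (0 < 12 * u ^ 2 + 24 * u * v + 18 * u * h + 96 * u + 5 * v * h + 20 * v +
    2 * h ^ 2 + 46 * h + 4) by nia.
  lia.
- assert (B : 4 * (6 * n * n + m * m + 9 * m * n - 28 * m - 22 * n - 4) <=
              43 * n * n - 144 * n - 16) by nia.
  remember (n - k) as l eqn:El; remember (k - l) as w eqn:Ew; remember (k - g) as v eqn:Ev.
  remember (g - 8) as u eqn:Eu.
  assert (n10 : 10 <= 2 * l + w) by lia.
  assert (l0 : 0 <= l) by lia; assert (w0 : 0 <= w) by lia.
  assert (v0 : 0 <= v) by lia; assert (u0 : 0 <= u) by lia.
  assert (g = k - v) by lia; assert (u = k - v - 8) by lia; assert (n = k + l) by lia.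
  assert (k = l + w) by lia.
  clear - H B H1 l0 w0 v0 u0 n10 H0 H2 H3 H4; subst g u n k.
  assert (0 <= v * (l + w - v - 8)) by nia.
  assert (0 <= l * (l + w - v - 8)) by nia.
  assert (0 < 16 * l * w + 5 * w * w + 4 * w * v - 48 * w + 80 * v + 16).
  { destruct (Z.le_gt_cases w 10); nia. }
  lia.
Qed.

(* In the variables t = k - m and h = n - 2 m, all products needed are of nonnegative terms. *)
Lemma short_cycle_arith_shifted (m t h g p q d r z xi : Z) :
  5 <= m -> 0 <= t -> 0 <= h -> t <= m + h -> 3 <= g <= 7 -> 0 <= p <= g ->
  4 * d <= g * g < 4 * d + 4 -> g <= m + t ->
  p <= m + h - t -> g - p <= 2 * t -> g - p <= r -> r <= 2 * t -> 0 <= z ->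
  (p = 0 -> m + t = g /\ m + h - t = 0) -> (p = 0 -> q = 0) -> (1 <= p -> q = p - 1) ->
  (p = 1 -> g <= 5 -> 5 * (2 * m + h - 5) <= z /\ (r < 3 -> 6 * (2 * m + h) - 31 <= z)) ->
  d * (7 * (2 * m + h) - (m + t) - 3 * g) + 7 * q * (2 * m + h - g)
   + (m + h - t) * (7 * (m + t) + 8 * (m + h - t))
   + (m + t - g) * (13 * (m + t) + 15 * (m + h - t)) + z
   <= xi + 3 * (p * q) + 8 * (m + h - t) + 28 * (m + t - g) ->
  6 * (2 * m + h) * (2 * m + h) + m * m + 9 * m * (2 * m + h) - 28 * m - 22 * (2 * m + h) - 4 < xi.
Proof.
intros m5 t0 h0 tm g3 pg dg gk pl tp rp rt z0 p0 q0 qp ex H.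
assert (P : 0 <= m - 5) by lia.
assert (Q : 0 <= m + h - t) by lia.
remember (m - 5) as m' eqn:Em. assert (m = m' + 5) by lia. subst m. clear Em.
remember (m' + 5 + h - t) as l eqn:El.
assert (g = 3 \/ g = 4 \/ g = 5 \/ g = 6 \/ g = 7) as Eg by lia.
assert (p = 0 \/ p = 1 \/ p = 2 \/ p = 3 \/ p = 4 \/ p = 5 \/ p = 6 \/ p = 7) as Ep by lia.
destruct Eg as [Eg|[Eg|[Eg|[Eg|Eg]]]]; subst g;
 [assert (d = 2) by lia|assert (d = 4) by lia|assert (d = 6) by lia|assert (d = 9) by lia|
  assert (d = 12) by lia];
 subst d; clear dg;
 destruct Ep as [Ep|[Ep|[Ep|[Ep|[Ep|[Ep|[Ep|Ep]]]]]]]; subst p.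
all: try (exfalso; clear - pg; lia).
all: try (assert (q = 0) by (apply q0; reflexivity); exfalso; clear H ex; lia).
all: match type of qp with 1 <= ?p -> _ => 
   assert (E : q = p - 1) by (apply qp; lia); simpl in E; subst q end.
all: clear q0 qp p0 m5 t0 tm pg.
(* [g - p <= 2 * t] bounds [t] below by half of [g - p], rounded up; [s] is the excess of [t] over
   that. *)
all: match type of tp with ?a <= _ => let b := eval compute in ((a + 1) / 2) in
   assert (T : b <= t) by (clear - tp; lia);
   remember (t - b) as s eqn:Es; assert (S0 : 0 <= s) by lia;
   assert (St : t = s + b) by lia; subst t; clear Es T tp end.
all: assert (H2 : 0 <= s * m') by (apply Z.mul_nonneg_nonneg; assumption).
all: assert (H3 : 0 <= h * m') by (apply Z.mul_nonneg_nonneg; assumption).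
all: assert (H4 : 0 <= h * s) by (apply Z.mul_nonneg_nonneg; assumption).
all: assert (H5 : 0 <= h * h) by (apply Z.mul_nonneg_nonneg; assumption).
all: assert (H1 : 0 <= s * l) by (apply Z.mul_nonneg_nonneg; assumption).
all: subst l.
all: ring_simplify in H; ring_simplify in H1.
all: match type of pl with 1 <= _ => idtac | _ => clear ex rp rt; match type of pl with
  | ?p <= _ => match type of gk with ?g <= _ => lazymatch constr:((g, p)) with
     (6, 6) => lia | (7, 5) => lia | (7, 6) => lia | (7, 7) => lia | _ => clear pl gk; lia end end end end.
(* Left are the goals with [p = 1] and [g] from 3 to 7; the gain of a balanced cut is available for
   [g <= 5]. *)
4-5: clear ex rp rt pl gk; lia.
- destruct (ex (Logic.eq_refl _) ltac:(lia)) as [X1 X2]; clear ex.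
  destruct (Z.lt_ge_cases r 3) as [r3|r3].
    specialize (X2 r3); clear - H H1 H2 H3 H4 H5 P Q S0 X2 h0; lia.
  (* [3 <= r <= 2 * t] gives [t >= 2], that is [s >= 1]. *)
  assert (H6 : 0 <= (s - 1) * m') by (apply Z.mul_nonneg_nonneg; lia).
  clear - H H1 H2 H3 H4 H5 H6 P Q S0 X1 h0; lia.
- destruct (ex (Logic.eq_refl _) ltac:(lia)) as [X1 X2]; clear - H H1 H2 H3 H4 H5 P Q S0 X1 h0; lia.
- destruct (ex (Logic.eq_refl _) ltac:(lia)) as [X1 X2]; clear - H H1 H2 H3 H4 H5 P Q S0 X1 h0; lia.
Qed.

(* m: matching number; k and L: numbers of non-leaves and of leaves; g: length of
   the cycle, K = k - g; p: number of cycle vertices carrying a tree, q = p - 1;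
   r: number of cycle vertices without a leaf neighbour; d = floor (g^2 / 4): sum
   of the distances on the cycle from a fixed vertex; z: gain of the balanced cuts;
   a and b: the sizes of the two sides of one cut; xi: the eccentric distance sum.
   For g >= 8 the bound d >= 4 g - 16 suffices, and p, r and z play no role. *)
Lemma cycle_arith (m k L K g p q d r z xi : Z) :
  5 <= m -> 2 * m <= k + L -> 3 <= g -> 0 <= p <= g -> 0 <= L ->
  4 * d <= g * g < 4 * d + 4 -> g + K = k -> 0 <= K ->
  p <= L -> g <= r + p -> 2 * m + r <= 2 * k -> 0 <= r <= g -> 0 <= z ->
  (p = 0 -> k = g /\ L = 0) -> (p = 0 -> q = 0) -> (1 <= p -> q = p - 1) ->
  (p = 1 -> g <= 5 -> exists a b, a + b = k + L /\ 3 <= a /\ g <= b /\ (a - 2) * (6 * b - 13) <= z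
     /\ (b = g -> g <= r)) ->
  d * (3 * g + 6 * K + 7 * L) + 7 * q * (K + L) + L * (7 * k + 8 * L) + K * (13 * k + 15 * L) + z
   <= xi + 3 * (p * q) + 8 * L + 28 * K ->
  6 * (k + L) * (k + L) + m * m + 9 * m * (k + L) - 28 * m - 22 * (k + L) - 4 < xi.
Proof.
intros m5 mn g3 pg L0 dg gK K0 pl pr rt rg z0 p0 q0 qp ex H.
assert (K = k - g) by lia; subst K.
destruct (Z.le_gt_cases 8 g) as [g8|g8].
- assert (q1 : 0 <= q) by lia.
  assert (pq : 3 * (p * q) <= 7 * q * (k - g + L)) by nia.
  assert (dg' : 4 * g - 16 <= d) by nia.
  apply (long_cycle_arith (k + L) m k g d); try lia.
- assert (E := short_cycle_arith_shifted m (k - m) (k + L - 2 * m) g p q d r z xi).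
  replace (2 * m + (k + L - 2 * m)) with (k + L) in E by ring.
  replace (m + (k - m)) with k in E by ring.
  replace (m + (k + L - 2 * m) - (k - m)) with L in E by ring.
  apply E; clear E; try lia.
  intros p1 g5; destruct (ex p1 g5) as (a & b & ab & a3 & gb & az & br).
  apply (excess_arith a b (k + L) g r z); assumption || lia.
Qed.

Local Open Scope nat_scope.

Lemma cycle_arith_nat (m K L g p d r z xi : nat) :
  5 <= m -> 2 * m <= g + K + L -> 3 <= g -> p <= g -> 4 * d + odd g = g * g ->
  p <= L -> g <= r + p -> 2 * m + r <= 2 * (g + K) -> r <= g ->
  (p = 0 -> K = 0 /\ L = 0) ->
  (p = 1 -> g <= 5 -> exists a b, a + b = g + K + L /\ 3 <= a /\ g <= b /\ (a - 2) * (6 * b - 13) <= z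
     /\ (b = g -> g <= r)) ->
  d * (3 * g + 6 * K + 7 * L) + 7 * p.-1 * (K + L) + L * (7 * (g + K) + 8 * L)
    + K * (13 * (g + K) + 15 * L) + z <= xi + 3 * (p * p.-1) + 8 * L + 28 * K ->
  6 * (g + K + L) * (g + K + L) + m * m + 9 * m * (g + K + L)
   < xi + 28 * m + 22 * (g + K + L) + 4.
Proof.
move=> m5 mn g3 pg dg pL pr rt rg p0 ex H.
have := cycle_arith (Z.of_nat m) (Z.of_nat (g + K)) (Z.of_nat L) (Z.of_nat K) (Z.of_nat g)
  (Z.of_nat p) (Z.of_nat p.-1) (Z.of_nat d) (Z.of_nat r) (Z.of_nat z) (Z.of_nat xi).
have -> : Z.of_nat (g + K) = (Z.of_nat g + Z.of_nat K)%Z by lia.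
move=> ca; suff : (6 * (Z.of_nat g + Z.of_nat K + Z.of_nat L) * (Z.of_nat g + Z.of_nat K + Z.of_nat L)
  + Z.of_nat m * Z.of_nat m + 9 * Z.of_nat m * (Z.of_nat g + Z.of_nat K + Z.of_nat L)
  - 28 * Z.of_nat m - 22 * (Z.of_nat g + Z.of_nat K + Z.of_nat L) - 4 < Z.of_nat xi)%Z by lia.
have p0' : (Z.of_nat p = 0 -> Z.of_nat g + Z.of_nat K = Z.of_nat g /\ Z.of_nat L = 0)%Z.
  by clear -p0 => h; have [|-> ->] := p0; lia.
apply: ca => //; clear p0 p0'; try (clear H ex; lia); last by clear ex; lia.
move=> p1 g5; have [p1' g5'] : p = 1 /\ g <= 5 by clear ex H; lia.
have [a [b [ab [a3 [gb [az br]]]]]] := ex p1' g5'.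
exists (Z.of_nat a), (Z.of_nat b); clear H ex; repeat split; try lia.
Qed.

End IntegerInequalities.

(** * Inequalities for a tree of depth 2 plus an edge *)

Section StarLikeInequalities.
Import ZArith.
Local Open Scope Z_scope.

(* k and s: numbers of vertices at depth 1 and 2; q: sum of the squares of the numbers
   of children at depth 1; red: total saving due to the edge outside the tree.  Below,
   t is the number of vertices at depth 1 with children, r = k - t, e = s - t, and Q is
   the sum of the squares of the numbers of children other than the first. *)
Definition estimate (k s q red xi : Z) :=
  (1 + k + s) * (3 * k + 8 * s) + (2 + 3 * k + 4 * s) * (k + 2 * s)
   <= xi + 2 * (3 * k + 7 * s + 4 * q) + 8 * s + red.

Definition bound (m n : Z) := 6 * n * n + m * m + 9 * m * n - 28 * m - 22 * n - 4.

Lemma bound_mono m m' n : 0 <= m -> m <= m' -> 4 <= n -> bound m n <= bound m' n.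
Proof. intros; unfold bound; nia. Qed.

Lemma bound_mono_strict m m' n : 0 <= m -> m < m' -> 4 <= n -> bound m n < bound m' n.
Proof. intros; unfold bound; nia. Qed.

(** The estimate rewritten around the target for [m = t + 1]. The constant 38 is the saving of a
    pentagon: the remainder vanishes for [red = 38] and [e = Q = 0]. *)
Lemma estimate_expand t e r Q red xi : estimate (t + r) (t + e) (t + 2 * e + Q) red xi ->
  bound (t + 1) (1 + (t + r) + (t + e)) + 38 - red +
   e * (9 * (2 * t + r + e) + 2 * t + e - 25) - 8 * Q <= xi.
Proof. unfold estimate, bound; lia. Qed.

(** The same around [m = t + 2]. For [e = 0], [t >= 3] and nonnegative [red], [r] and [Q] the
    remainder is negative, which is where [U_{n,m}] escapes; a strict inequality has to come from
    [e >= 1]. *)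
Lemma estimate_expand2 t e r Q red xi : estimate (t + r) (t + e) (t + 2 * e + Q) red xi ->
  bound (t + 2) (1 + (t + r) + (t + e)) + 54 - red +
   (e - 1) * (9 * (2 * t + r + e) + 2 * t) + e * e - 25 * e - 8 * Q <= xi.
Proof. unfold estimate, bound; lia. Qed.

(** Two childless ends at depth 1 gain 1 towards each other, with weight 3 each, so [red = 6]. *)
Lemma case_triangle_bare m t e r Q xi :
  3 <= t -> 0 <= e -> 2 <= r -> Q <= e * e -> 0 <= m -> m <= t + 1 \/ (m = t + 2 /\ 1 <= e) ->
  estimate (t + r) (t + e) (t + 2 * e + Q) 6 xi -> bound m (1 + (t + r) + (t + e)) < xi.
Proof.
intros t3 e0 r2 Qe m0 [m1|[-> e1]] H.
- apply estimate_expand in H; assert (M := bound_mono m (t + 1) (1 + (t + r) + (t + e))).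
  assert (0 <= e * (t - 3)) by nia; assert (0 <= e * (r - 2)) by nia; lia.
- apply estimate_expand2 in H.
  assert (0 <= (e - 1) * (t - 3)) by nia; assert (0 <= (e - 1) * (r - 2)) by nia.
  assert (0 <= (e - 1) * (e - 1)) by nia; lia.
Qed.

(** The ends at depth 1 have [x] and [y] children, [b] and [c] of them beyond the first. Every pair
    from the two branches gains 1, with weight 3 at an end and 4 at a child: [red] is
    [(3 + 4 x) (1 + y) + (3 + 4 y) (1 + x)]. *)
Lemma case_triangle m t e r Q x y b c xi :
  4 <= t -> 0 <= e -> 0 <= r -> 0 <= b -> 0 <= c -> b + c <= e -> Q + 2 * (b * c) <= e * e ->
  0 <= x <= 1 + b -> 0 <= y <= 1 + c -> 0 <= m -> m <= t + 1 ->
  estimate (t + r) (t + e) (t + 2 * e + Q) (6 + 7 * (x + y) + 8 * (x * y)) xi ->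
  bound m (1 + (t + r) + (t + e)) < xi.
Proof.
intros t4 e0 r0 b0 c0 bc Qe x0 y0 m0 m1 H.
apply estimate_expand in H; assert (M := bound_mono m (t + 1) (1 + (t + r) + (t + e))).
assert (x * y <= (1 + b) * (1 + c)) by nia; assert (0 <= b * c) by nia.
assert (0 <= e * (t - 4)) by nia; assert (0 <= e * r) by nia; lia.
Qed.

(** Two siblings at depth 2 gain 1 towards each other, with weight 4 each, so [red = 8]. *)
Lemma case_far_triangle m t e r Q xi :
  3 <= t -> 1 <= e -> 0 <= r -> Q <= e * e -> 0 <= m -> m <= t + 2 ->
  estimate (t + r) (t + e) (t + 2 * e + Q) 8 xi -> bound m (1 + (t + r) + (t + e)) < xi.
Proof.
intros t3 e1 r0 Qe m0 m1 H.
apply estimate_expand2 in H; assert (M := bound_mono m (t + 2) (1 + (t + r) + (t + e))).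
assert (0 <= (e - 1) * (t - 3)) by nia; assert (0 <= (e - 1) * r) by nia.
assert (0 <= (e - 1) * (e - 1)) by nia; lia.
Qed.

(** The end at depth 1 has [x] children; its branch and the other end, at depth 2, gain 2 towards
    each other: [red] is [2 ((3 + 4 x) + 4 (1 + x))]. *)
Lemma case_square m t e r Q x b xi :
  4 <= t -> 0 <= e -> 0 <= r -> 0 <= b -> b <= e -> Q <= e * e ->
  0 <= x <= 1 + b -> 0 <= m -> m <= t + 1 ->
  estimate (t + r) (t + e) (t + 2 * e + Q) (14 + 16 * x) xi ->
  bound m (1 + (t + r) + (t + e)) < xi.
Proof.
intros t4 e0 r0 b0 be Qe x0 m0 m1 H.
apply estimate_expand in H; assert (M := bound_mono m (t + 1) (1 + (t + r) + (t + e))).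
assert (0 <= e * (t - 4)) by nia; assert (0 <= e * r) by nia; lia.
Qed.

Lemma case_square_bare m t e r Q xi :
  3 <= t -> 1 <= e -> 1 <= r -> Q <= e * e -> 0 <= m -> m <= t + 2 ->
  estimate (t + r) (t + e) (t + 2 * e + Q) 14 xi -> bound m (1 + (t + r) + (t + e)) < xi.
Proof.
intros t3 e1 r0 Qe m0 m1 H.
apply estimate_expand2 in H; assert (M := bound_mono m (t + 2) (1 + (t + r) + (t + e))).
assert (0 <= (e - 1) * (t - 3)) by nia; assert (0 <= (e - 1) * (r - 1)) by nia.
assert (0 <= (e - 1) * (e - 1)) by nia; lia.
Qed.

(** The two ends at depth 2 gain 3 towards each other, with weights 4 and 4, and each gains 1 with
    the parent of the other, with weights 4 and 3: [24 + 7 + 7 = 38]. Each further child in these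
    two branches gains 1 with the opposite end, adding 8. *)
Lemma case_pentagon m t e r Q b c xi :
  4 <= t -> 0 <= e -> 0 <= r -> 0 <= b -> 0 <= c -> b + c <= e -> Q + 2 * (b * c) <= e * e ->
  0 <= m -> m <= t + 1 ->
  estimate (t + r) (t + e) (t + 2 * e + Q) (38 + 8 * (b + c)) xi ->
  bound m (1 + (t + r) + (t + e)) < xi \/
  bound m (1 + (t + r) + (t + e)) <= xi /\ e = 0 /\ m = t + 1.
Proof.
intros t4 e0 r0 b0 c0 bc Qe m0 m1 H.
apply estimate_expand in H; assert (M := bound_mono m (t + 1) (1 + (t + r) + (t + e))).
assert (M' := bound_mono_strict m (t + 1) (1 + (t + r) + (t + e))).
assert (0 <= b * c) by nia.
assert (0 <= e * (t - 4)) by nia; assert (0 <= e * r) by nia; lia.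
Qed.

Lemma case_pentagon_full m t e r Q b c xi :
  3 <= t -> 0 <= r -> 1 <= b -> 1 <= c -> b + c <= e -> Q + 2 * (b * c) <= e * e ->
  0 <= m -> m <= t + 2 ->
  estimate (t + r) (t + e) (t + 2 * e + Q) (38 + 8 * (b + c)) xi ->
  bound m (1 + (t + r) + (t + e)) < xi.
Proof.
intros t3 r0 b1 c1 bc Qe m0 m1 H.
apply estimate_expand2 in H; assert (M := bound_mono m (t + 2) (1 + (t + r) + (t + e))).
assert (1 <= b * c) by nia.
assert (0 <= (e - 2) * (t - 3)) by nia; assert (0 <= (e - 2) * r) by nia.
assert (0 <= (e - 2) * (e - 2)) by nia; lia.
Qed.

Local Open Scope nat_scope.

Definition estimate_nat (k s q red xi : nat) :=
  (1 + k + s) * (3 * k + 8 * s) + (2 + 3 * k + 4 * s) * (k + 2 * s)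
   <= xi + 2 * (3 * k + 7 * s + 4 * q) + 8 * s + red.

(* [bound m n < xi] and [bound m n <= xi], with the negative terms moved to the right. *)
Definition bound_lt (m n xi : nat) := 6 * n * n + m * m + 9 * m * n < xi + 28 * m + 22 * n + 4.
Definition bound_le (m n xi : nat) := 6 * n * n + m * m + 9 * m * n <= xi + 28 * m + 22 * n + 4.

Lemma bound_ltP m n xi : bound_lt m n xi <-> (bound (Z.of_nat m) (Z.of_nat n) < Z.of_nat xi)%Z.
Proof. by rewrite /bound_lt /bound; lia. Qed.

Lemma bound_leP m n xi : bound_le m n xi <-> (bound (Z.of_nat m) (Z.of_nat n) <= Z.of_nat xi)%Z.
Proof. by rewrite /bound_le /bound; lia. Qed.

Lemma estimate_natP k s q red xi : estimate_nat k s q red xi ->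
  estimate (Z.of_nat k) (Z.of_nat s) (Z.of_nat q) (Z.of_nat red) (Z.of_nat xi).
Proof. by rewrite /estimate_nat /estimate; lia. Qed.

Lemma size_natP t r e : Z.of_nat (1 + (t + r) + (t + e)) =
  (1 + (Z.of_nat t + Z.of_nat r) + (Z.of_nat t + Z.of_nat e))%Z.
Proof. lia. Qed.

Lemma bound_lt_triangle_bare m t e r Q xi :
  3 <= t -> 2 <= r -> Q <= e * e -> m <= t + 1 \/ (m = t + 2 /\ 1 <= e) ->
  estimate_nat (t + r) (t + e) (t + 2 * e + Q) 6 xi -> bound_lt m (1 + (t + r) + (t + e)) xi.
Proof.
move=> t3 r2 Qe mt /estimate_natP H; apply/bound_ltP; rewrite size_natP.
apply: (case_triangle_bare _ (Z.of_nat t) (Z.of_nat e) (Z.of_nat r) (Z.of_nat Q));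
  last (by move: H; rewrite /estimate; lia); lia.
Qed.

Lemma bound_lt_triangle m t e r Q x y b c xi :
  4 <= t -> b + c <= e -> Q + 2 * (b * c) <= e * e -> x <= 1 + b -> y <= 1 + c -> m <= t + 1 ->
  estimate_nat (t + r) (t + e) (t + 2 * e + Q) (6 + 7 * (x + y) + 8 * (x * y)) xi ->
  bound_lt m (1 + (t + r) + (t + e)) xi.
Proof.
move=> t4 bc Qe xb yc mt /estimate_natP H; apply/bound_ltP.
rewrite size_natP.
apply: (case_triangle _ (Z.of_nat t) (Z.of_nat e) (Z.of_nat r) (Z.of_nat Q) (Z.of_nat x)
  (Z.of_nat y) (Z.of_nat b) (Z.of_nat c)); last (by move: H; rewrite /estimate; lia); lia.
Qed.

Lemma bound_lt_far_triangle m t e r Q xi :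
  3 <= t -> 1 <= e -> Q <= e * e -> m <= t + 2 ->
  estimate_nat (t + r) (t + e) (t + 2 * e + Q) 8 xi -> bound_lt m (1 + (t + r) + (t + e)) xi.
Proof.
move=> t3 e1 Qe mt /estimate_natP H; apply/bound_ltP; rewrite size_natP.
apply: (case_far_triangle _ (Z.of_nat t) (Z.of_nat e) (Z.of_nat r) (Z.of_nat Q));
  last (by move: H; rewrite /estimate; lia); lia.
Qed.

Lemma bound_lt_square m t e r Q x b xi :
  4 <= t -> b <= e -> Q <= e * e -> x <= 1 + b -> m <= t + 1 ->
  estimate_nat (t + r) (t + e) (t + 2 * e + Q) (14 + 16 * x) xi ->
  bound_lt m (1 + (t + r) + (t + e)) xi.
Proof.
move=> t4 be Qe xb mt /estimate_natP H; apply/bound_ltP; rewrite size_natP.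
apply: (case_square _ (Z.of_nat t) (Z.of_nat e) (Z.of_nat r) (Z.of_nat Q) (Z.of_nat x) (Z.of_nat b));
  last (by move: H; rewrite /estimate; lia); lia.
Qed.

Lemma bound_lt_square_bare m t e r Q xi :
  3 <= t -> 1 <= e -> 1 <= r -> Q <= e * e -> m <= t + 2 ->
  estimate_nat (t + r) (t + e) (t + 2 * e + Q) 14 xi -> bound_lt m (1 + (t + r) + (t + e)) xi.
Proof.
move=> t3 e1 r1 Qe mt /estimate_natP H; apply/bound_ltP; rewrite size_natP.
apply: (case_square_bare _ (Z.of_nat t) (Z.of_nat e) (Z.of_nat r) (Z.of_nat Q));
  last (by move: H; rewrite /estimate; lia); lia.
Qed.

Lemma bound_lt_pentagon m t e r Q b c xi :
  4 <= t -> b + c <= e -> Q + 2 * (b * c) <= e * e -> m <= t + 1 ->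
  estimate_nat (t + r) (t + e) (t + 2 * e + Q) (38 + 8 * (b + c)) xi ->
  bound_lt m (1 + (t + r) + (t + e)) xi \/
  [/\ bound_le m (1 + (t + r) + (t + e)) xi, e = 0 & m = t + 1].
Proof.
move=> t4 bc Qe mt /estimate_natP H.
have : (bound (Z.of_nat m) (Z.of_nat (1 + (t + r) + (t + e))) < Z.of_nat xi \/
  bound (Z.of_nat m) (Z.of_nat (1 + (t + r) + (t + e))) <= Z.of_nat xi /\
  Z.of_nat e = 0 /\ Z.of_nat m = Z.of_nat t + 1)%Z.
  rewrite size_natP; apply: (case_pentagon _ _ _ _ (Z.of_nat Q) (Z.of_nat b) (Z.of_nat c));
  last (by move: H; rewrite /estimate; lia); lia.
case=> [/bound_ltP|[/bound_leP lt [e0 mt']]]; [by left|by right; split=> //; lia].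
Qed.

Lemma bound_lt_pentagon_full m t e r Q b c xi :
  3 <= t -> 1 <= b -> 1 <= c -> b + c <= e -> Q + 2 * (b * c) <= e * e -> m <= t + 2 ->
  estimate_nat (t + r) (t + e) (t + 2 * e + Q) (38 + 8 * (b + c)) xi ->
  bound_lt m (1 + (t + r) + (t + e)) xi.
Proof.
move=> t3 b1 c1 bc Qe mt /estimate_natP H; apply/bound_ltP; rewrite size_natP.
apply: (case_pentagon_full _ (Z.of_nat t) (Z.of_nat e) (Z.of_nat r) (Z.of_nat Q)
  (Z.of_nat b) (Z.of_nat c)); last (by move: H; rewrite /estimate; lia); lia.
Qed.

End StarLikeInequalities.

Set Implicit Arguments.
Unset Strict Implicit.
Unset Printing Implicit Defensive.

(** * Distances, matchings and spanning trees *)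

Section Distance.
Variable G : sgraph.
Implicit Types x y z u v : G.

Lemma dist_le_size x y p :
  path (@adj G) x p -> last x p = y -> dist x y <= size p.
Proof.
move=> px lx; have [ltp|] := ltnP (size p) #|G|; last first.
  move=> h; apply: leq_trans h; rewrite /dist.
  by apply: leq_trans (find_size _ _) _; rewrite size_iota.
rewrite leqNgt; apply/negP => /(before_find 0); rewrite nth_iota // add0n.
move/negbT/negP; apply; apply/existsP; exists (in_tuple p).
by rewrite /= px lx eqxx.
Qed.

Lemma distxx x : dist x x = 0.
Proof. by have := @dist_le_size x x [::] isT erefl; rewrite leqn0 => /eqP. Qed.

Lemma dist_adj x y : adj x y -> dist x y <= 1.
Proof. by move=> xy; apply: (@dist_le_size x y [:: y]) => //=; rewrite xy. Qed.

Hypothesis conn : connected G.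

Lemma dist_path x y :
  exists p, [/\ path (@adj G) x p, last x p = y & size p = dist x y].
Proof.
have [p0 p0x ->] := connectP (conn x y).
have [p px /= up _] := shortenP p0x.
set z := last x p.
(* A simple path has fewer than [#|G|] edges, so the search in [dist] succeeds and its default value
   is not reached. *)
have szp : size p < #|G| by rewrite -[_.+1]/(size (x :: p)) -(@card_uniqP _ (x :: p) up) max_card.
set P := fun k : nat => [exists q : k.-tuple G, path (@adj G) x q && (last x q == z)].
have hasP : has P (iota 0 #|G|).
  apply/hasP; exists (size p); first by rewrite mem_iota.
  by apply/existsP; exists (in_tuple p); rewrite /= px eqxx.
have lt : find P (iota 0 #|G|) < #|G| by rewrite -[X in _ < X](size_iota 0) -has_find.
have := nth_find 0 hasP; rewrite nth_iota //.
rewrite add0n => /existsP[q /andP[qx /eqP lq]].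
by exists q; split=> //; rewrite size_tuple.
Qed.

Lemma dist_lipschitz (f : G -> nat) x y :
  (forall u v, adj u v -> f v <= (f u).+1) -> f y <= f x + dist x y.
Proof.
move=> fL; have [p [px <- <-]] := dist_path x y.
elim: p x px => [|z p IH] x /= => [_|/andP[xz pz]]; first by rewrite addn0.
by apply: leq_trans (IH _ pz) _; rewrite addnS -addSn leq_add2r fL.
Qed.

Lemma dist_triangle x y z : dist x z <= dist x y + dist y z.
Proof.
have [p [px lp <-]] := dist_path x y; have [q [qy lq <-]] := dist_path y z.
rewrite -size_cat; apply: dist_le_size; first by rewrite cat_path px lp.
by rewrite last_cat lp.
Qed.

Lemma dist_sym x y : dist x y = dist y x.
Proof.
suff le (u v : G) : dist u v <= dist v u by apply/eqP; rewrite eqn_leq !le.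
have := @dist_lipschitz (fun w => dist w v) v u; rewrite distxx add0n; apply.
move=> w z wz; apply: leq_trans (dist_triangle z w v) _.
by rewrite -addn1 addnC leq_add2l dist_adj // adj_sym.
Qed.

Lemma dist_pred x y k : dist x y = k.+1 -> exists2 z, adj x z & dist z y <= k.
Proof.
have [[|z p] [/= px lp <-]] := dist_path x y => //.
move: px => /andP[xz zp] [<-]; exists z => //; exact: dist_le_size lp.
Qed.

Lemma dist_eq0 x y : dist x y = 0 -> x = y.
Proof. by have [[|z p] [/= px lp <-]] := dist_path x y. Qed.

Lemma ecc_le v u : dist u v <= ecc v.
Proof. exact: (@leq_bigmax _ (fun u => dist u v)). Qed.

End Distance.

(** * Matchings and half-integral covers *)

Section HalfCover.
Variable G : sgraph.

Lemma edgesP (e : {set G}) :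
  reflect (exists x y, adj x y /\ e = [set x; y]) (e \in edges G).
Proof.
apply: (iffP imset2P) => [[x y _ xy ->]|[x [y [xy ->]]]].
  by exists x, y; split=> //; move: xy; rewrite !inE.
by exists x y; rewrite ?inE.
Qed.

Lemma adj_neq (x y : G) : adj x y -> x != y.
Proof. by apply: contraTneq => ->; rewrite adj_irrefl. Qed.

(* Weak duality between matchings and half-integral vertex covers. *)
Lemma half_cover (phi : G -> nat) :
  (forall x y, adj x y -> 2 <= phi x + phi y) ->
  2 * matching_number G <= \sum_x phi x.
Proof.
move=> cov.
have [M Mm ->] : {M : {set {set G}} | is_matching M & matching_number G = #|M|}.
  apply: eq_bigmax_cond; apply/card_gt0P; exists set0.
  by rewrite unfold_in /is_matching sub0set /trivIset /cover !big_set0 cards0.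
have /andP[ME Mt] := Mm.
rewrite mulnC -sum_nat_const.
apply: (@leq_trans (\sum_(e in M) \sum_(x in e) phi x)).
  apply: leq_sum => e /(subsetP ME)/edgesP[x [y [xy ->]]].
  by rewrite big_setU1 ?inE ?adj_neq //= big_set1 cov.
by rewrite -big_trivIset //= big_mkcond; apply: leq_sum => x _; case: ifP.
Qed.

Lemma matching_half : 2 * matching_number G <= #|G|.
Proof.
apply: leq_trans (half_cover (phi := fun=> 1) _) _ => //.
by rewrite sum1_card.
Qed.

End HalfCover.

(** * Rooted spanning forests *)

Section Parents.
Variable G : sgraph.
Implicit Types (C : {set G}) (x y : G).

(** A spanning forest with root set [C]; the strictly decreasing level excludes cycles. A single
    root gives a spanning tree, and the vertex set of the cycle gives the hanging trees. *)
Definition parent_to C (lev : G -> nat) (par : G -> G) :=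
  forall x, x \notin C -> adj x (par x) /\ lev (par x) < lev x.

Definition parent_edges C (par : G -> G) : {set {set G}} :=
  [set [set x; par x] | x in ~: C].

Lemma parent_to_exists C (lev : G -> nat) :
  (forall x, x \notin C -> exists2 y, adj x y & lev y < lev x) ->
  exists par, parent_to C lev par.
Proof.
move=> h; exists (fun x => odflt x [pick y | adj x y && (lev y < lev x)]).
move=> x xC; case: pickP => [y /andP[]//|/= n]; have [y xy ly] := h x xC.
by have := n y; rewrite xy ly.
Qed.

Lemma parent_to_set C c0 : connected G -> c0 \in C ->
  exists lev par, parent_to C lev par.
Proof.
move=> conn c0C; pose cl x := [arg min_(c < c0 in C) dist x c].
have clP x : cl x \in C /\ forall c, c \in C -> dist x (cl x) <= dist x c.
  by rewrite /cl; case: arg_minnP.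
exists (fun x => dist x (cl x)); apply: parent_to_exists => x xC.
have [clC _] := clP x; case E: (dist x (cl x)) => [|k].
  by move: xC; rewrite (dist_eq0 conn E) clC.
have [y xy yk] := dist_pred conn E; exists y => //.
by rewrite ltnS; apply: leq_trans yk; have [_] := clP y; apply.
Qed.

Lemma parent_to1 c : connected G ->
  exists par, parent_to [set c] (fun x => dist x c) par.
Proof.
move=> conn; apply: parent_to_exists => x; rewrite inE => xc.
case E: (dist x c) => [|k]; first by move: xc; rewrite (dist_eq0 conn E) eqxx.
by have [y xy yk] := dist_pred conn E; exists y.
Qed.

Lemma set2_eqP (x y u v : G) : [set x; y] = [set u; v] ->
  x = u /\ y = v \/ x = v /\ y = u.
Proof.
move=> E; have := set21 x y; have := set22 x y; rewrite E !inE.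
have := set21 u v; have := set22 u v; rewrite -E !inE.
by do 4! [case/orP=> /eqP ?]; subst; auto.
Qed.

Variables (C : {set G}) (lev : G -> nat) (par : G -> G).
Hypothesis parP : parent_to C lev par.

Lemma parent_edges_sub : parent_edges C par \subset edges G.
Proof.
apply/subsetP => _ /imsetP[x xC ->]; apply/edgesP.
by exists x, (par x); split=> //; case: (parP (x := x)) => //; rewrite -in_setC.
Qed.

(** The edge [{x, par x}] determines [x]: of two vertices that are parents of each other, each would
    have the smaller level. *)
Lemma card_parent_edges : #|parent_edges C par| + #|C| = #|G|.
Proof.
rewrite card_in_imset; first by rewrite addnC cardsC.
move=> x y; rewrite !inE => xC yC /set2_eqP[[]//|[xy yx]].
have [_] := parP xC; have [_] := parP yC; rewrite -xy yx => l1 l2.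
by have := ltn_trans l1 l2; rewrite ltnn.
Qed.

Lemma parent_edgesP x y : reflect (x \notin C /\ y = par x \/ y \notin C /\ x = par y)
  ([set x; y] \in parent_edges C par).
Proof.
apply: (iffP imsetP) => [[z]|].
  by rewrite inE => zC /set2_eqP[[-> ->]|[-> ->]]; [left|right].
case=> [[xC ->]|[yC ->]]; first by exists x; rewrite ?inE.
by exists y; rewrite ?inE // setUC.
Qed.

End Parents.

(** * The edge outside a spanning tree *)

Section ExtraEdge.
Variables (G : sgraph) (c : G) (lev : G -> nat) (par : G -> G).
Hypotheses (Guni : unicyclic G) (parP : parent_to [set c] lev par).

(** A unicyclic graph has [#|G|] edges and the tree uses [#|G| - 1] of them, so exactly one edge
    remains. *)
Lemma extra_edge : exists a b : G, [/\ adj a b,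
  ~ (a != c /\ b = par a), ~ (b != c /\ a = par b) &
  forall x y, adj x y -> [\/ x != c /\ y = par x, y != c /\ x = par y,
     x = a /\ y = b | x = b /\ y = a]].
Proof.
have [conn En] := Guni; have sub := parent_edges_sub parP.
have cardP := card_parent_edges parP; rewrite cards1 addn1 En in cardP.
have : #|edges G :\: parent_edges [set c] par| = 1.
  by have := cardsID (parent_edges [set c] par) (edges G); rewrite (setIidPr sub); lia.
move=> /eqP/cards1P[e Ee].
have := set11 e; rewrite -Ee inE => /andP[eP /edgesP[a [b [ab eab]]]].
exists a, b; split=> //.
- by move=> [ac ba]; case/negP: eP; rewrite eab; apply/parent_edgesP; left; rewrite inE.
- by move=> [ac ba]; case/negP: eP; rewrite eab; apply/parent_edgesP; right; rewrite inE.
move=> x y xy; have xyE : [set x; y] \in edges G by apply/edgesP; exists x, y.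
have [/parent_edgesP|xyP] := boolP ([set x; y] \in parent_edges [set c] par).
  by rewrite !inE; case=> ?; [constructor 1|constructor 2].
have : [set x; y] \in [set e] by rewrite -Ee inE xyP.
by rewrite inE eab => /eqP/set2_eqP[[]|[]] ? ?; [constructor 3|constructor 4].
Qed.

End ExtraEdge.

(** * Existence of a cycle *)

Section FindCycle.
Variable (G : sgraph).
Hypotheses (Guni : unicyclic G).

(* The edge outside a spanning tree closes the tree path between its ends. *)
Lemma unicyclic_cycle (c : G) : exists s : seq G, [/\ uniq s, cycle (@adj G) s & 2 < size s].
Proof.
have [conn En] := Guni.
have [par parP] := parent_to1 c conn.
have [a [b [ab nab nba Eadj]]] := extra_edge Guni parP.
pose e : rel G := fun x y => (x != c) && (y == par x) || (y != c) && (x == par y).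
have esym : symmetric e by move=> x y; rewrite /e orbC.
have eadj x y : e x y -> adj x y.
  case/orP=> /andP[h /eqP->]; first by have [] := parP x; rewrite ?inE.
  by rewrite adj_sym; have [] := parP y; rewrite ?inE.
have toc x : connect e x c.
  have [k] := ubnP (dist x c); elim: k x => // k IH x; rewrite ltnS => lx.
  have [->|xc] := eqVneq x c; first exact: connect0.
  have [|xp lp] := parP x; first by rewrite inE.
  have ex : e x (par x) by rewrite /e xc eqxx.
  have pc : connect e (par x) c by apply: IH; apply: leq_trans lp lx.
  exact: connect_trans (connect1 ex) pc.
have : connect e a b.
  by apply: connect_trans (toc a) _; rewrite (sym_connect_sym esym) toc.
case/connectP => p0 p0a lb; move: lb; case: (shortenP p0a) => p pa up _ lb.
exists (a :: p); split=> //.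
  rewrite /= rcons_path -lb adj_sym ab andbT.
  by apply: sub_path pa => x y; apply: eadj.
case: p pa lb {up} => [|x [|y p]] //=.
  by move=> _ ba; move: ab; rewrite ba adj_irrefl.
rewrite andbT => eax bx; rewrite -bx in eax.
by case/orP: eax => /andP[h /eqP h']; [case: nab|case: nba].
Qed.

End FindCycle.

(** * All eccentricities at least 3: a cycle with hanging trees *)

Section CycleDistance.
Variable g : nat.

(** The two truncated differences add up to the absolute value of [i - j], so this is the distance
    on the cycle of length [g]. *)
Definition cycdist (i j : nat) := minn ((i - j) + (j - i)) (g - ((i - j) + (j - i))).

Lemma cycdistii i : cycdist i i = 0.
Proof. by rewrite /cycdist; lia. Qed.

Lemma cycdistC i j : cycdist i j = cycdist j i.
Proof. by rewrite /cycdist; lia. Qed.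

Lemma modn_succ j : j < g -> j.+1 %% g = if j.+1 == g then 0 else j.+1.
Proof. by move=> jg; case: eqP => [->|?]; [rewrite modnn|rewrite modn_small; lia]. Qed.

Lemma cycdist_succ i j : i < g -> j < g ->
  cycdist i (j.+1 %% g) <= (cycdist i j).+1 /\ cycdist i j <= (cycdist i (j.+1 %% g)).+1.
Proof. by move=> ig jg; rewrite modn_succ // /cycdist; case: eqP; lia. Qed.

Lemma cycdist_gt0 i j : i < g -> j < g -> i != j -> 0 < cycdist i j.
Proof. by rewrite /cycdist; lia. Qed.

End CycleDistance.

(** The sum is the integer part of [g ^ 2 / 4], stated without division. Induction in steps of two:
    from [g] to [g + 2], shifting the index by one raises every old minimum by one, and the new end
    terms are 0 and 1. *)
Lemma sum_minn_complement g : 4 * (\sum_(d < g) minn d (g - d)) + odd g = g ^ 2.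
Proof.
have [k] := ubnP g; elim: k g => // k IH [|[|g]]; first by rewrite big_ord0.
  by rewrite big_ord1.
rewrite !ltnS => lg; have lg' : g < k by lia.
have := IH g lg'; rewrite big_ord_recl /= big_ord_recr /=.
under [X in _ = _ -> 4 * (_ + (X + _)) + _ = _]eq_bigr => i _.
  rewrite (_ : minn _ _ = minn i (g - i) + 1); last by rewrite /bump; have := ltn_ord i; lia.
  over.
rewrite big_split /= sum1_card card_ord /bump negbK; move: (\sum_(i < g) _) => S.
by rewrite !expnS !expn0; lia.
Qed.

(** Substitute [d = i - j] for [j <= i], and [d = g + i - j] for [i < j]. *)
Lemma sum_cycdist g i : i < g -> \sum_(j < g) cycdist g i j = \sum_(d < g) minn d (g - d).
Proof.
move=> ig; rewrite -!(big_mkord xpredT (fun d => minn d (g - d))) -(big_mkord xpredT (cycdist g i)).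
rewrite [LHS](big_cat_nat (n := i.+1)) //= [RHS](big_cat_nat (n := i.+1)) //=.
congr (_ + _).
  rewrite [RHS]big_nat_rev /=; apply: eq_big_nat => j /andP[_ ji]; rewrite /cycdist; lia.
rewrite [RHS]big_nat_rev /=.
by apply: eq_big_nat => j /andP[ij jg]; rewrite /cycdist; lia.
Qed.

(** The terms of the product involving the bare cycle sum exactly to the multiple of [delta]. For
    two distinct positions carrying trees of sizes [u = y i + l i] and [v = y j + l j], the rest is
    at least [(3 u + 1) v], since the distance and [l i] are at least 1; and [(3 u + 1) v + 3 - (3 u
    + 4 v) = 3 (u - 1) (v - 1) >= 0]. Summing [3 u + 4 v - 3] over ordered pairs gives the terms in
    [p]. *)
Lemma cycle_weights_sum g delta (y l : 'I_g -> nat) :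
  (forall i : 'I_g, \sum_(j < g) cycdist g i j = delta) ->
  (forall i, 0 < y i -> 0 < l i) ->
  forall p, p = #|[set i | 0 < l i]| ->
  delta * (3 * g + 6 * \sum_i y i + 7 * \sum_i l i) + 7 * p.-1 * (\sum_i y i + \sum_i l i)
  <= \sum_(i < g) \sum_(j < g) cycdist g i j * ((3 + 3 * y i + 4 * l i) * (1 + y j + l j)) + 3 * (p * p.-1).
Proof.
move=> dP yl p Ep.
have -> : \sum_(i < g) \sum_(j < g) cycdist g i j * ((3 + 3 * y i + 4 * l i) * (1 + y j + l j)) =
  delta * (3 * g + 6 * (\sum_i y i) + 7 * (\sum_i l i)) +
  \sum_(i < g) \sum_(j < g) cycdist g i j * ((3 * y i + 4 * l i) * (y j + l j)).
  transitivity (\sum_(i < g) \sum_(j < g) cycdist g i j * (3 + 3 * y i + 4 * l i) +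
     \sum_(i < g) \sum_(j < g) cycdist g i j * (3 * (y j + l j)) +
     \sum_(i < g) \sum_(j < g) cycdist g i j * ((3 * y i + 4 * l i) * (y j + l j))).
    rewrite -!big_split; apply: eq_bigr => i _ /=.
    by rewrite -!big_split; apply: eq_bigr => j _ /=; nia.
  have -> : \sum_(i < g) \sum_(j < g) cycdist g i j * (3 + 3 * y i + 4 * l i) =
      delta * (3 * g + 3 * (\sum_i y i) + 4 * (\sum_i l i)).
    transitivity (\sum_(i < g) delta * (3 + 3 * y i + 4 * l i)).
      by apply: eq_bigr => i _; rewrite -big_distrl /= dP.
    rewrite -big_distrr; congr (_ * _).
    by rewrite 2!big_split sum_nat_const card_ord -!big_distrr (mulnC g).
  have -> : \sum_(i < g) \sum_(j < g) cycdist g i j * (3 * (y j + l j)) =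
      delta * (3 * (\sum_i y i + \sum_i l i)).
    rewrite exchange_big /= -big_split !big_distrr; apply: eq_bigr => j _ /=.
    rewrite -big_distrl /= -(dP j); congr (_ * _).
    by apply: eq_bigr => i _; rewrite cycdistC.
  by move: (\sum_(i < g) \sum_(j < g) _) => T; nia.
rewrite -!addnA leq_add2l.
set P := [set i | 0 < l i] in Ep.
have big_P (F : 'I_g -> nat) : (forall i, i \notin P -> F i = 0) -> \sum_i F i = \sum_(i in P) F i.
  by move=> F0; rewrite [RHS]big_mkcond; apply: eq_bigr => i _; case: ifPn => // /F0.
have nP i : i \notin P -> y i = 0 /\ l i = 0.
  by rewrite inE -eqn0Ngt => /eqP li; split=> //; have := yl i; lia.
have cP i : i \in P -> #|P :\ i| = p.-1 by move=> iP; rewrite Ep (cardsD1 i P) iP.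
have -> : 3 * (p * p.-1) = \sum_(i in P) \sum_(j in P :\ i) 3.
  rewrite (eq_bigr (fun=> p.-1 * 3)) ?sum_nat_const; first by rewrite -Ep; nia.
  by move=> i iP; rewrite sum_nat_const cP.
apply: (@leq_trans (\sum_(i in P) \sum_(j in P :\ i) (3 * (y i + l i) + 4 * (y j + l j)))).
  have -> : \sum_(i in P) \sum_(j in P :\ i) (3 * (y i + l i) + 4 * (y j + l j)) =
    \sum_(i in P) (p.-1 * (3 * (y i + l i))) + \sum_(i in P) (p.-1 * (4 * (y i + l i))).
    transitivity (\sum_(i in P) \sum_(j in P :\ i) 3 * (y i + l i) +
                  \sum_(i in P) \sum_(j in P :\ i) 4 * (y j + l j)).
      by rewrite -big_split; apply: eq_bigr => i _; rewrite -big_split.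
    congr (_ + _); first by apply: eq_bigr => i iP; rewrite sum_nat_const cP.
    rewrite (exchange_big_dep (mem P)) /=; last by move=> i j _; rewrite !inE => /andP[].
    apply: eq_bigr => j jP; rewrite sum_nat_const; congr (_ * _).
    rewrite -(cP j jP); apply: eq_card => i.
    by rewrite [RHS]in_setD1 unfold_in /= in_setD1 jP andbT andbC eq_sym.
  have -> : \sum_i y i + \sum_i l i = \sum_(i in P) (y i + l i).
    by rewrite -big_split; apply: big_P => i /nP[-> ->].
  by rewrite -big_split big_distrr; apply: leq_sum => i _ /=; nia.
rewrite (big_P (fun i => \sum_(j < g) cycdist g i j * ((3 * y i + 4 * l i) * (y j + l j))));
  last by move=> i /nP[-> ->]; rewrite big1 // => j _; rewrite !muln0.
apply: (@leq_trans (\sum_(i in P)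
    (\sum_(j < g) cycdist g i j * ((3 * y i + 4 * l i) * (y j + l j)) + \sum_(j in P :\ i) 3)));
  last by rewrite big_split.
apply: leq_sum => i iP.
apply: (@leq_trans (\sum_(j in P :\ i)
    (cycdist g i j * ((3 * y i + 4 * l i) * (y j + l j)) + 3))); last first.
  rewrite big_split leq_add2r [X in _ <= X](bigID (mem (P :\ i))); exact: leq_addr.
apply: leq_sum => j; rewrite in_setD1 => /andP[ji jP].
have := cycdist_gt0 (ltn_ord i) (ltn_ord j); rewrite eq_sym => /(_ ji).
move: iP jP; rewrite !inE; move: (cycdist _ _ _) => d li lj d0.
have H : (3 * y i + 4 * l i) * (y j + l j) <= d * ((3 * y i + 4 * l i) * (y j + l j)).
  by rewrite leq_pmull.
nia.
Qed.

Lemma fconnect_inv (T : finType) (f : T -> T) (x y : T) : fconnect f x y = (x == y) || fconnect f (f x) y.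
Proof.
apply/idP/orP => [/iter_findex|[/eqP->|fxy]]; first by case: (findex f x y) => [<-|n];
  [left|rewrite iterSr => <-; right; apply: fconnect_iter].
  exact: connect0.
exact: connect_trans (fconnect1 f x) fxy.
Qed.

(** * A cycle with hanging trees and its distances *)

Section HangingTrees.
Variables (G : sgraph) (s : seq G) (lev : G -> nat) (par : G -> G).
Hypotheses (Guni : unicyclic G) (s_uniq : uniq s) (s_cycle : cycle (@adj G) s).
Hypotheses (s_size : 2 < size s) (parP : parent_to [set x in s] lev par).
Implicit Types x y z : G.

Local Notation g := (size s).

Lemma par_adj x : x \notin s -> adj x (par x).
Proof. by move=> xs; have [] := parP (x := x) _; rewrite ?inE. Qed.

Lemma par_lev x : x \notin s -> lev (par x) < lev x.
Proof. by move=> xs; have [] := parP (x := x) _; rewrite ?inE. Qed.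

Lemma cycle_nth x0 i : i < g -> adj (nth x0 s i) (nth x0 s (i.+1 %% g)).
Proof.
case: s s_size s_cycle => // c p _ /=; move/(pathP x0); rewrite size_rcons => h ip.
have := h i ip; rewrite -rcons_cons nth_rcons /= ip nth_rcons.
case: (ltngtP i (size p)) => [lt|gt|->]; [by rewrite modn_small|by lia|by rewrite modnn].
Qed.

Lemma next_idx x : x \in s ->
  [/\ index x s < g, nth x s (index x s) = x,
      index (nth x s ((index x s).+1 %% g)) s = (index x s).+1 %% g
    & nth x s ((index x s).+1 %% g) \in s].
Proof.
move=> xs; have lt : (index x s).+1 %% g < g by rewrite ltn_pmod //; lia.
by rewrite index_mem nth_index // index_uniq // mem_nth.
Qed.

Definition succ x := nth x s ((index x s).+1 %% g).

Lemma succ_mem x : x \in s -> succ x \in s.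
Proof. by case/next_idx. Qed.

Lemma index_succ x : x \in s -> index (succ x) s = (index x s).+1 %% g.
Proof. by case/next_idx. Qed.

Lemma succ_adj x : x \in s -> adj x (succ x).
Proof.
move=> xs; have [lt nx _ _] := next_idx xs.
by have := cycle_nth x lt; rewrite nx.
Qed.

(** The [g] cycle edges, distinct because [g > 2], and the [#|G| - g] parent edges are disjoint
    families, and together they are as numerous as all edges of a unicyclic graph. *)
Lemma adj_cases x y : adj x y ->
  [\/ x \notin s /\ y = par x, y \notin s /\ x = par y,
      x \in s /\ y = succ x | y \in s /\ x = succ y].
Proof.
have [conn En] := Guni.
pose Ec : {set {set G}} := [set [set x; succ x] | x in [set x in s]].
have cEc : #|Ec| = #|[set x in s]|.
  rewrite card_in_imset // => u v; rewrite !inE => us vs /set2_eqP[[]//|[uv vu]].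
  have := index_succ us; have := index_succ vs; rewrite vu -uv.
  have [iu _ _ _] := next_idx us; have [iv _ _ _] := next_idx vs.
  rewrite !modn_succ //; move: iu iv; move: (index u s) (index v s) => i j ig jg.
  by case: (i.+1 =P g); case: (j.+1 =P g); lia.
have Ecs : Ec \subset edges G.
  apply/subsetP => e /imsetP[u]; rewrite inE => us ->; apply/edgesP.
  by exists u, (succ u); rewrite succ_adj.
have disj : [disjoint Ec & parent_edges [set x in s] par].
  apply/pred0P => e /=; apply/negP => /andP[/imsetP[u]]; rewrite inE => us ->.
  by case/parent_edgesP; rewrite inE; case; rewrite ?us ?succ_mem.
have cU : #|Ec :|: parent_edges [set x in s] par| = #|edges G|.
  have := card_parent_edges parP; have := leq_card_setU Ec (parent_edges [set x in s] par).
  by rewrite disj => -[_ /eqP->]; rewrite cEc; lia.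
have sub : Ec :|: parent_edges [set x in s] par \subset edges G.
  by rewrite subUset Ecs (parent_edges_sub parP).
have EE : edges G = Ec :|: parent_edges [set x in s] par.
  by apply/eqP; rewrite eq_sym eqEcard sub cU leqnn.
move=> xy; have : [set x; y] \in edges G by apply/edgesP; exists x, y.
rewrite EE inE => /orP[/imsetP[u]|/parent_edgesP]; rewrite !inE.
  by move=> us /set2_eqP[[-> ->]|[-> ->]]; [constructor 3|constructor 4].
by case=> ?; [constructor 1|constructor 2].
Qed.

(* One step towards the cycle; enough iterations reach [root x]. *)
Definition step x := if x \in s then x else par x.
Definition root x := iter (\max_y lev y) step x.
Definition pos x := index (root x) s.

Lemma root_mem x : root x \in s.
Proof.
have H n y : lev y <= n -> iter n step y \in s.
  elim: n y => [|n IH] y ly.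
    by apply: contraT => ys; have := leq_trans (par_lev ys) ly.
  rewrite iterSr; have [ys|ys] := boolP (y \in s).
    have -> : step y = y by rewrite /step ys.
    by elim: n {IH ly} => //= n IH; rewrite /step IH.
  have -> : step y = par y by rewrite /step (negPf ys).
  by apply: IH; rewrite -ltnS; apply: leq_trans (par_lev ys) ly.
exact/H/(leq_bigmax x).
Qed.

Lemma root_id x : x \in s -> root x = x.
Proof.
by move=> xs; rewrite /root; elim: (\max_y _) => //= n ->; rewrite /step xs.
Qed.

Lemma root_par x : x \notin s -> root (par x) = root x.
Proof.
move=> xs; have -> : par x = step x by rewrite /step (negPf xs).
by rewrite {1}/root -iterSr iterS -/(root x) /step root_mem.
Qed.

Lemma pos_lt x : pos x < g.
Proof. by rewrite index_mem root_mem. Qed.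

Lemma pos_par x : x \notin s -> pos (par x) = pos x.
Proof. by move=> xs; rewrite /pos root_par. Qed.

(* z lies outside the cycle, on the path from y to the cycle. *)
Definition anc z y := (z \notin s) && fconnect step y z.

Lemma anc_mem z y : y \in s -> anc z y = false.
Proof.
move=> ys; apply/negP => /andP[zs /iter_findex E]; move: zs; rewrite -E.
apply/negP; rewrite negbK.
by elim: (findex _ _ _) => [|n IH] /=; rewrite ?ys // /step IH.
Qed.

Lemma anc_step z y : y \notin s -> anc z y = (z == y) || anc z (par y).
Proof.
move=> ys; rewrite /anc fconnect_inv {2}/step (negPf ys) eq_sym.
by case: eqP => [->|_] //=; rewrite ys.
Qed.

Lemma anc_refl z : z \notin s -> anc z z.
Proof. by move=> zs; rewrite /anc zs connect0. Qed.

Lemma anc_lev z y : anc z y -> lev z <= lev y.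
Proof.
case/andP=> _ /iter_findex <-; elim: (findex _ _ _) => //= n; apply: leq_trans.
by rewrite /step; case: ifPn => // /par_lev/ltnW.
Qed.

Lemma anc_par y : y \notin s -> anc y (par y) = false.
Proof.
by move=> ys; apply/negP => /anc_lev; rewrite leqNgt par_lev.
Qed.

(* For fixed x the left-hand side changes by at most 1 along every edge.  The sum counts
   the edges {z, par z} separating x from y. *)
Lemma dist_ge x y :
  cycdist g (pos x) (pos y) + \sum_(z in [predC s]) (anc z x (+) anc z y : nat) <= dist x y.
Proof.
have [conn _] := Guni.
pose h w := \sum_(z in [predC s]) (anc z x (+) anc z w : nat).
have := @dist_lipschitz _ conn (fun w => cycdist g (pos x) (pos w) + h w) x y.
have hx : h x = 0 by rewrite /h big1 // => z _; rewrite addbb.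
rewrite cycdistii hx; apply=> u v uv.
(* Passing from [w] to [par w] changes only the summand for [z = w]. *)
have hpar w : w \notin s -> h w <= (h (par w)).+1 /\ h (par w) <= (h w).+1.
  move=> ws; rewrite /h !(bigD1 (P := [in [predC s]]) w) //=.
  rewrite (eq_bigr (fun z => (anc z x (+) anc z (par w)) : nat)); last first.
    by move=> z /andP[_ zw]; rewrite (@anc_step z w) // (negPf zw).
  by rewrite (@anc_step w w) // eqxx anc_par //=; case: (anc w x) => /=; lia.
have hs w : w \in s -> h w = \sum_(z in [predC s]) anc z x.
  by move=> ws; apply: eq_bigr => z _; rewrite (@anc_mem z w) // addbF.
have hsucc w : w \in s -> pos (succ w) = (pos w).+1 %% g.
  by move=> ws; rewrite /pos !root_id ?succ_mem ?index_succ.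
case: (adj_cases uv) => [[us ->]|[vs ->]|[us ->]|[vs ->]].
- by rewrite pos_par //; have := hpar u us; lia.
- by rewrite pos_par //; have := hpar v vs; lia.
- rewrite hsucc // !hs ?succ_mem //.
  by have [] := cycdist_succ (g := g) (pos_lt x) (pos_lt u); lia.
- rewrite hsucc // !hs ?succ_mem //.
  by have [] := cycdist_succ (g := g) (pos_lt x) (pos_lt v); lia.
Qed.

(** * Leaves, their eccentricities and the cover *)

Definition has_child x := [exists y, (y \notin s) && (par y == x)].
(** Cycle vertices count as internal, so the vertices that are not internal are exactly those of
    degree one. *)
Definition internal x := (x \in s) || has_child x.

Lemma has_childP x : reflect (exists2 y, y \notin s & par y = x) (has_child x).
Proof.
apply: (iffP existsP) => [[y /andP[ys /eqP yx]]|[y ys yx]]; exists y => //.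
by rewrite ys yx eqxx.
Qed.

Lemma internal_par x : x \notin s -> internal (par x).
Proof. by move=> xs; apply/orP; right; apply/has_childP; exists x. Qed.

Lemma notin_leaf x : ~~ internal x -> x \notin s.
Proof. by rewrite negb_or => /andP[]. Qed.

Lemma leaf_adj x y : ~~ internal x -> adj x y -> y = par x.
Proof.
move=> nx /adj_cases[[]//|[ys xy]|[xs _]|[ys xy]].
- by rewrite xy internal_par in nx.
- by rewrite (negPf (notin_leaf nx)) in xs.
- by have := notin_leaf nx; rewrite xy succ_mem.
Qed.

Lemma leaf_dist x y : ~~ internal x -> x != y -> dist (par x) y < dist x y.
Proof.
move=> nx xy; have [conn _] := Guni.
case E: (dist x y) => [|k]; first by move: xy; rewrite (dist_eq0 conn E) eqxx.
by have [z /(leaf_adj nx)-> ] := dist_pred conn E.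
Qed.

(** Every walk leaving a leaf passes through its parent. A vertex farthest from the parent is not
    the leaf itself, because it is at distance more than 1, so it is one step farther from the
    leaf. *)
Lemma ecc_leaf x : ~~ internal x -> 1 < ecc (par x) -> ecc (par x) < ecc x.
Proof.
have [conn _] := Guni; move=> nx.
have [|y Ey] := eq_bigmax (fun y => dist y (par x)); first by apply/card_gt0P; exists x.
rewrite /ecc Ey -/(ecc x) (dist_sym conn) => e1; have xy : x != y.
  apply: contraTneq e1 => <-; rewrite -leqNgt dist_adj // adj_sym.
  exact/par_adj/notin_leaf.
by apply: leq_trans (leaf_dist nx xy) _; rewrite (dist_sym conn) ecc_le.
Qed.

(** The cover takes the value 0 on leaves, 1 on cycle vertices without a leaf neighbour and 2 on the
    other internal vertices. The only neighbour of a leaf is its parent, which therefore has the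
    value 2. *)
Lemma half_cover_tree :
  2 * matching_number G + #|[set x in s | [forall y, (y \notin s) ==> (par y == x) ==> internal y]]|
  <= 2 * #|[set x | internal x]|.
Proof.
set R := [set x in s | _].
pose phi x : nat := if internal x then (if x \in R then 1 else 2) else 0.
have phiE : \sum_x phi x + #|R| = 2 * #|[set x | internal x]|.
  rewrite mulnC -sum_nat_const -sum1_card big_mkcond [in X in _ + X]big_mkcond -big_split.
  rewrite [RHS]big_mkcond; apply: eq_bigr => x _ /=; rewrite /phi !inE.
  by rewrite /internal; case: (x \in s) => //=; case: ifP.
rewrite -phiE leq_add2r; apply: half_cover => x y xy.
wlog nx : x y xy / ~~ internal x => [th|].
  have [ix|] := boolP (internal x); last exact: th.
  have [iy|ny] := boolP (internal y); last by rewrite addnC th // adj_sym.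
  by rewrite /phi ix iy; do 2 case: ifP.
have ys := leaf_adj nx xy; rewrite {2}/phi ys internal_par ?notin_leaf //.
case: ifP => [|_]; last exact: leq_addl.
rewrite inE => /andP[_ /forallP/(_ x)].
by rewrite notin_leaf // eqxx (negPf nx).
Qed.

(** * Cuts given by the edges outside the cycle *)

Definition subtree z := [set x | anc z x].

Lemma anc_child z x : anc z x -> x != z -> has_child z.
Proof.
move=> /andP[zs /iter_findex]; case: (findex _ _ _) => [<-|n /= E _]; first by rewrite eqxx.
apply/has_childP; move: E; set y := iter _ _ _; rewrite /step; case: ifPn => [ys yz|ys yz].
  by rewrite yz (negPf zs) in ys.
by exists y.
Qed.

Lemma subtree_leaf z : ~~ internal z -> subtree z = [set z].
Proof.
move=> nz; have zs := notin_leaf nz; apply/setP => x; rewrite !inE.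
apply/idP/eqP => [azx|->]; last exact: anc_refl.
apply/eqP; apply: contraNT nz => xz; apply/orP; right; exact: anc_child azx xz.
Qed.

Lemma anc_trans_par z x y : anc z x -> y \notin s -> par y = x -> anc z y.
Proof. by move=> azx ys yx; rewrite anc_step // yx azx orbT. Qed.

(** Among the vertices off the cycle satisfying [P], one of maximal level has no child. *)
Lemma leaf_below (P : pred G) x0 : P x0 -> x0 \notin s ->
  (forall x y, P x -> y \notin s -> par y = x -> P y) ->
  exists x, [/\ P x, x \notin s & ~~ internal x].
Proof.
move=> Px0 x0s Pc; have Q0 : P x0 && (x0 \notin s) by rewrite Px0.
have [x /andP[Px xs] mx] := @arg_maxnP _ x0 (fun x => P x && (x \notin s)) lev Q0.
exists x; split=> //; rewrite /internal (negPf xs) /=; apply/has_childP => -[y ys yx].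
have := mx y; rewrite (Pc _ _ Px ys yx) ys => /(_ isT); have := par_lev ys.
by rewrite yx => lt le; have := leq_ltn_trans le lt; rewrite ltnn.
Qed.

(* A lower bound for [ecc x] when all eccentricities are at least 3 (see [ecc_leaf]). *)
Definition weight x : nat := 3 + ~~ internal x.

Lemma cut_sum (e : G -> nat) (T : {set G}) :
  \sum_x \sum_y e x * ((x \in T) (+) (y \in T) : nat) =
  (\sum_(x in T) e x) * #|~: T| + (\sum_(x in ~: T) e x) * #|T|.
Proof.
rewrite (bigID (mem T)) /=; congr (_ + _).
  rewrite big_distrl; apply: eq_bigr => x xT; rewrite -big_distrr -sum1_card /=.
  congr (_ * _); rewrite [RHS]big_mkcond; apply: eq_bigr => y _.
  by rewrite xT inE; case: (y \in T).
rewrite big_distrl; apply: eq_big => x; first by rewrite inE.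
move=> xT; rewrite -big_distrr -sum1_card /=.
congr (_ * _); rewrite [RHS]big_mkcond; apply: eq_bigr => y _.
by rewrite (negPf xT); case: (y \in T).
Qed.

Lemma weight_sum (T : {set G}) :
  \sum_(x in T) weight x = 3 * #|T :&: [set x | internal x]| + 4 * #|T :\: [set x | internal x]|.
Proof.
rewrite (big_setID [set x | internal x]) /= mulnC [4 * _]mulnC -!sum_nat_const.
by congr (_ + _); apply: eq_bigr => x; rewrite !inE /weight => /andP[]; [move=> _|move=> + _] => ->.
Qed.

Local Notation I := [set x | internal x].

(** The cut isolates [z], of weight 4, from vertices of total weight
    [3 * #|I| + 4 * (#|~: I| - 1)]. *)
Lemma cut_leaf z : ~~ internal z ->
  \sum_x \sum_y weight x * (anc z x (+) anc z y : nat) + 8 =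
  7 * #|I| + 8 * #|~: I|.
Proof.
move=> nz; have E x : anc z x = (x \in subtree z) by rewrite inE.
under eq_bigr => x _ do under eq_bigr => y _ do rewrite !E.
rewrite cut_sum !weight_sum subtree_leaf //.
have -> : [set z] :&: I = set0 by apply/setP => x; rewrite !inE; case: eqP => // ->; rewrite (negPf nz).
have -> : [set z] :\: I = [set z] by apply/setP => x; rewrite !inE; case: eqP => [->|_]; rewrite ?nz ?andbF.
have -> : ~: [set z] :&: I = I.
  by apply/setP => x; rewrite !inE; case: eqP => // ->; rewrite (negPf nz).
have -> : #|~: [set z] :\: I| = #|~: I|.-1.
  rewrite (cardsD1 z (~: I)) !inE nz; apply: eq_card => x; rewrite !inE; exact: andbC.
have : 0 < #|~: I| by apply/card_gt0P; exists z; rewrite !inE.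
have := cardsC I; have := cardsC [set z]; rewrite cards1 cards0; lia.
Qed.

(** Equality holds when the subtree is [z] with a single leaf: these two vertices account for
    [13 + 15 = 28]. Each further vertex of the subtree, internal or not, adds at least
    [6 * #|~: subtree z| - 13]. *)
Lemma cut_internal z : z \notin s -> internal z ->
  13 * #|I| + 15 * #|~: I| + (#|subtree z| - 2) * (6 * #|~: subtree z| - 13) <=
  \sum_x \sum_y weight x * (anc z x (+) anc z y : nat) + 28.
Proof.
move=> zs iz; have E x : anc z x = (x \in subtree z) by rewrite inE.
under [X in _ <= X + _]eq_bigr => x _ do under eq_bigr => y _ do rewrite !E.
rewrite cut_sum !weight_sum; set T := subtree z.
have i1 : 0 < #|T :&: I| by apply/card_gt0P; exists z; rewrite !inE anc_refl.
have l1 : 0 < #|T :\: I|.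
  have [|x [ax _ nx]] := @leaf_below (anc z) z (anc_refl zs) zs.
    by move=> x y; apply: anc_trans_par.
  by apply/card_gt0P; exists x; rewrite !inE ax nx.
have j3 : 2 < #|~: T :&: I|.
  apply: leq_trans s_size _; rewrite -(card_uniqP s_uniq) subset_leq_card //.
  by apply/subsetP => x xs; rewrite !inE anc_mem // /internal xs.
have <- : #|T :&: I| + #|~: T :&: I| = #|I| by rewrite -(cardsID T I) setDE !(setIC I).
have <- : #|T :\: I| + #|~: T :\: I| = #|~: I|.
  by rewrite -(cardsID T (~: I)) !setDE !(setIC (~: I)).
rewrite -(cardsID I T) -(cardsID I (~: T)).
move: i1 l1 j3; move: #|T :&: I| #|T :\: I| #|~: T :&: I| #|~: T :\: I| => i l j k.
case: i => // i; case: l => // l _ _ j3.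
have -> : i.+1 + l.+1 - 2 = i + l by lia.
(* The complement contains the cycle, so [j >= 3] and the subtraction of 13 is not truncated. *)
have : exists b, 6 * (j + k) = b + 13 by exists (6 * (j + k) - 13); lia.
by case=> b bE; rewrite bE addnK; nia.
Qed.

(** * Grouping the vertices by their position on the cycle *)

Definition pos_ord x : 'I_g := Ordinal (pos_lt x).

Definition inner_at (i : 'I_g) := #|[set x | [&& x \notin s, internal x & pos_ord x == i]]|.
Definition leaves_at (i : 'I_g) := #|[set x | ~~ internal x && (pos_ord x == i)]|.

Lemma sum_fibers (P : pred G) :
  \sum_i #|[set x | P x && (pos_ord x == i)]| = #|[set x | P x]|.
Proof.
rewrite -[RHS]sum1_card (partition_big pos_ord xpredT) //=.
by apply: eq_bigr => i _; rewrite -sum1_card; apply: eq_bigl => x; rewrite !inE.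
Qed.

Lemma sum_inner_at : \sum_i inner_at i + g = #|I|.
Proof.
transitivity (#|[set x | (x \notin s) && internal x]| + #|[set x in s]|).
  congr (_ + _); last by rewrite cardsE; have := card_uniqP s_uniq => <-.
  rewrite -sum_fibers; apply: eq_bigr => i _; congr #|pred_of_set _|.
  by apply/setP => x; rewrite !inE andbA.
rewrite addnC -(cardsID [set x in s] I); congr (_ + _); apply: eq_card => x;
by rewrite !inE /internal; case: (x \in s); rewrite ?andbF.
Qed.

Lemma sum_leaves_at : \sum_i leaves_at i = #|~: I|.
Proof. by rewrite sum_fibers; apply: eq_card => x; rewrite !inE. Qed.

Lemma sum_fiber (a b : nat) i :
  \sum_(x | pos_ord x == i) (if internal x then a else b) =
  a * (1 + inner_at i) + b * leaves_at i.
Proof.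
rewrite (bigID [in s]) /= [X in _ + X](bigID internal) /= addnA mulnDr muln1; congr (_ + _ + _).
- have x0 : G by case: (s) s_size.
  rewrite (big_pred1 (nth x0 s i)) => [|x]; first by rewrite /internal mem_nth.
  apply/andP/eqP => [[/eqP <- xs]|->]; first by rewrite /= /pos root_id // nth_index.
  have cs : nth x0 s i \in s by rewrite mem_nth.
  by split=> //; apply/eqP/val_inj; rewrite /= /pos root_id // index_uniq.
- rewrite mulnC -sum_nat_const; apply: eq_big => x; first by rewrite !inE -andbA andbC -andbA.
  by case/andP => _ ->.
- rewrite mulnC -sum_nat_const; apply: eq_big => x; last by case/andP=> _ /negPf->.
  rewrite !inE /internal; case: (x \in s) => /=; rewrite ?andbF ?andbT //; exact: andbC.
Qed.

Lemma pos_dist_sum :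
  \sum_x \sum_y weight x * cycdist g (pos x) (pos y) =
  \sum_(i < g) \sum_(j < g) cycdist g i j *
    ((3 + 3 * inner_at i + 4 * leaves_at i) * (1 + inner_at j + leaves_at j)).
Proof.
rewrite (partition_big pos_ord xpredT) //=; apply: eq_bigr => i _.
rewrite exchange_big (partition_big pos_ord xpredT) //=; apply: eq_bigr => j _.
transitivity (\sum_(y | pos_ord y == j) cycdist g i j * \sum_(x | pos_ord x == i) weight x).
  apply: eq_bigr => y /eqP yj; rewrite big_distrr; apply: eq_bigr => x /eqP xi /=.
  by rewrite -xi -yj mulnC.
have -> : \sum_(x | pos_ord x == i) weight x = 3 + 3 * inner_at i + 4 * leaves_at i.
  rewrite -(mulnDr 3 1) -sum_fiber; apply: eq_bigr => x _; rewrite /weight.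
  by case: (internal x).
have -> : 1 + inner_at j + leaves_at j = \sum_(y | pos_ord y == j) 1.
  by rewrite -[leaves_at j]mul1n -[1 + _]mul1n -sum_fiber; apply: eq_bigr => y _; rewrite if_same.
by rewrite mulnA big_distrr; apply: eq_bigr => y _; rewrite /= muln1.
Qed.

Lemma leaves_at_gt0 i : 0 < inner_at i -> 0 < leaves_at i.
Proof.
case/card_gt0P => x0; rewrite inE => /and3P[x0s _ x0i].
have [|x [/eqP xi _ nx]] := @leaf_below (fun x => pos_ord x == i) x0 x0i x0s.
  by move=> x y /eqP <- ys yx; apply/eqP/val_inj; rewrite /= -yx pos_par.
by apply/card_gt0P; exists x; rewrite inE nx xi eqxx.
Qed.

(** Since every tree has a leaf, this counts the cycle vertices that carry a tree. *)
Definition hung := #|[set i | 0 < leaves_at i]|.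

Definition excess z := (#|subtree z| - 2) * (6 * #|~: subtree z| - 13).

(** With [weight] for the eccentricity and [dist_ge] for the distance, the double sum splits into a
    sum along the cycle and one cut for each vertex off the cycle. Of these cuts, [#|~: I|] isolate
    a leaf and [#|I| - g] have an internal vertex on top. *)
Lemma eds_lower_bound delta :
  (forall i : 'I_g, \sum_(j < g) cycdist g i j = delta) ->
  (forall x, weight x <= ecc x) ->
  delta * (3 * g + 6 * (#|I| - g) + 7 * #|~: I|) + 7 * hung.-1 * ((#|I| - g) + #|~: I|)
  + #|~: I| * (7 * #|I| + 8 * #|~: I|) + (#|I| - g) * (13 * #|I| + 15 * #|~: I|)
  + \sum_(z | (z \notin s) && internal z) excess z
  <= ecc_dist_sum G + 3 * (hung * hung.-1) + 8 * #|~: I| + 28 * (#|I| - g).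
Proof.
move=> dE we; have [conn _] := Guni.
have xiE : \sum_x \sum_y weight x * dist x y <= ecc_dist_sum G.
  apply: leq_sum => x _; rewrite -big_distrr /= leq_mul //; apply: leq_sum => y _.
  by rewrite (dist_sym conn).
have xiD : \sum_x \sum_y weight x * cycdist g (pos x) (pos y) +
    \sum_(z in [predC s]) \sum_x \sum_y weight x * (anc z x (+) anc z y : nat)
    <= ecc_dist_sum G.
  apply: leq_trans xiE; rewrite [X in _ + X <= _]exchange_big -big_split.
  apply: leq_sum => x _; rewrite [X in _ + X <= _]exchange_big -big_split.
  apply: leq_sum => y _; by rewrite /= -big_distrr -mulnDr leq_mul2l /= dist_ge.
have cyc := cycle_weights_sum dE leaves_at_gt0 (erefl hung).
rewrite -pos_dist_sum sum_leaves_at in cyc.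
have yE : \sum_i inner_at i = #|I| - g by rewrite -sum_inner_at addnK.
rewrite yE in cyc.
have cutE : #|~: I| * (7 * #|I| + 8 * #|~: I|) + (#|I| - g) * (13 * #|I| + 15 * #|~: I|)
    + \sum_(z | (z \notin s) && internal z) excess z <=
    \sum_(z in [predC s]) \sum_x \sum_y weight x * (anc z x (+) anc z y : nat)
    + 8 * #|~: I| + 28 * (#|I| - g).
  have cI : #|[set z | (z \notin s) && internal z]| = #|I| - g.
    rewrite -yE -sum_fibers; apply: eq_bigr => i _; apply: eq_card => x.
    by rewrite !inE andbA.
  rewrite [X in _ <= X + _ + _](bigID internal) /=.
  have lS c : \sum_(z | (z \notin s) && ~~ internal z) c = #|~: I| * c.
    rewrite -sum_nat_const; apply: eq_bigl => z.
    by rewrite !inE /internal; case: (z \in s).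
  have iS c : \sum_(z | (z \notin s) && internal z) c = (#|I| - g) * c.
    by rewrite -cI -sum_nat_const; apply: eq_bigl => z; rewrite inE.
  set X := \sum_(z | (z \notin s) && internal z) \sum_x _; set Y := \sum_(z | _ && ~~ _) _.
  have E1 : Y + #|~: I| * 8 = #|~: I| * (7 * #|I| + 8 * #|~: I|).
    by rewrite -!lS -big_split; apply: eq_bigr => z /andP[_ nz]; rewrite /= cut_leaf.
  have E2 : (#|I| - g) * (13 * #|I| + 15 * #|~: I|) +
      \sum_(z | (z \notin s) && internal z) excess z <= X + (#|I| - g) * 28.
    by rewrite -!iS -!big_split; apply: leq_sum => z /andP[zs iz]; apply: cut_internal.
  by move: E1 E2; move: (\sum_(z | _) _) => Z; lia.
move: cutE cyc xiD; move: (\sum_(z | _) _) (\sum_(z in _) _) (\sum_x _) => Z A A'.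
by rewrite -/hung; lia.
Qed.

(** * Distribution of the trees over the cycle *)

Definition unsupported := [set x in s | [forall y, (y \notin s) ==> (par y == x) ==> internal y]].

Lemma hungP x : x \notin s -> 0 < leaves_at (pos_ord x).
Proof.
move=> xs; have [ix|nx] := boolP (internal x).
  by apply/leaves_at_gt0/card_gt0P; exists x; rewrite inE xs ix eqxx.
by apply/card_gt0P; exists x; rewrite inE nx eqxx.
Qed.

(** A cycle vertex that carries no tree is vacuously unsupported. *)
Lemma hung_unsupported : g <= #|unsupported| + hung.
Proof.
have := cardsC [set i | 0 < leaves_at i]; rewrite card_ord -/hung addnC => {1}<-.
rewrite leq_add2r; apply: leq_trans (leq_imset_card pos_ord _); apply: subset_leq_card.
have x0 : G by case: (s) s_size.
apply/subsetP => i; rewrite !inE -eqn0Ngt => /eqP li; apply/imsetP.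
have cs : nth x0 s i \in s by rewrite mem_nth.
have ci : pos_ord (nth x0 s i) = i by apply/val_inj; rewrite /= /pos root_id // index_uniq.
exists (nth x0 s i) => //; rewrite inE cs /=; apply/forallP => y; apply/implyP => ys.
apply/implyP => /eqP yc; have := hungP ys.
by have -> : pos_ord y = i; [apply/val_inj; rewrite /= -pos_par // yc -[RHS]/(val i) -{2}ci|rewrite li].
Qed.

Lemma hung_le_leaves : hung <= #|~: I|.
Proof.
rewrite -sum_leaves_at /hung -sum1_card big_mkcond; apply: leq_sum => i _.
by rewrite inE; case: ifP.
Qed.

Lemma hung0 : hung = 0 -> #|I| = g /\ #|~: I| = 0.
Proof.
move=> h0; have a x : x \in s.
  apply: contraT => xs; have := hungP xs; move/eqP: h0; rewrite cards_eq0 => /eqP/setP/(_ (pos_ord x)).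
  by rewrite !inE => ->.
split; first by rewrite -(card_uniqP s_uniq); apply: eq_card => x; rewrite inE /internal a.
by apply: eq_card0 => x; rewrite !inE /internal a.
Qed.

(** The two arcs of the cycle between [x] and [y] have lengths [j] and [g - j]. *)
Lemma cycle_dist_le x y : x \in s -> y \in s ->
  exists2 j, j <= g & dist x y <= j /\ dist x y <= g - j.
Proof.
have [conn _] := Guni.
have H j u : u \in s -> iter j succ u \in s /\ (index (iter j succ u) s = (index u s + j) %% g /\ dist u (iter j succ u) <= j).
  move=> us; elim: j => [|j [ms [ij dj]]] /=.
    by rewrite addn0 modn_small ?index_mem ?distxx.
  split; [exact: succ_mem|split].
    by rewrite index_succ // ij -addn1 modnDml addn1 addnS.
  by apply: leq_trans (dist_triangle conn _ (iter j succ u) _) _;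
    rewrite -addn1 leq_add // dist_adj // succ_adj.
have K j u v : u \in s -> v \in s -> (index u s + j) %% g = index v s -> dist u v <= j.
  move=> us vs E; have [ms [ij dj]] := H j u us.
  by have <- : iter j succ u = v by rewrite -(nth_index u ms) ij E nth_index.
move=> xs ys; have ix : index x s < g by rewrite index_mem.
have iy : index y s < g by rewrite index_mem.
have [le|lt] := leqP (index x s) (index y s).
  exists (index y s - index x s); first lia.
  split; first by apply: K => //; rewrite modn_small; lia.
  rewrite (dist_sym conn); apply: K => //.
  rewrite (_ : _ + _ = index x s + g); last lia.
  by rewrite modnDr modn_small.
exists (index x s - index y s); first lia.
split; first by rewrite (dist_sym conn); apply: K => //; rewrite modn_small; lia.
apply: K => //; rewrite (_ : _ + _ = index y s + g); last lia.
by rewrite modnDr modn_small.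
Qed.

(** Let all trees hang from [u]. On a cycle of length at most 5 every vertex is within 2 of [u], so
    some [w] at distance at least 3 lies in a tree, and its grandparent [z] is still off the cycle.
    The subtree of [z] contains [z], [par w] and [w]. *)
Lemma deep_subtree : hung = 1 -> g <= 5 -> (forall x, 3 <= ecc x) ->
  exists z, [/\ z \notin s, internal z, 3 <= #|subtree z|, g <= #|~: subtree z| &
    #|~: subtree z| = g -> g <= #|unsupported|].
Proof.
have [conn _] := Guni.
move=> /eqP/cards1P[i0 i0P] g5 e3.
have pos0 x : x \notin s -> pos_ord x = i0.
  by move=> /hungP h; apply/set1P; rewrite -i0P inE.
have x0 : G by case: (s) s_size.
set u := nth x0 s i0; have us : u \in s by rewrite mem_nth.
have root0 x : x \notin s -> root x = u.
  by move=> xs; rewrite /u -(pos0 x xs) /= nth_index ?root_mem.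
have [|w Ew] := eq_bigmax (fun y => dist y u); first by apply/card_gt0P; exists u.
have := e3 u; rewrite /ecc Ew => dw.
have ws : w \notin s.
  apply/negP => ws; have [j jg [d1 d2]] := cycle_dist_le ws us; move: dw d1 d2 g5.
  by move: (dist w u) => d; lia.
have d1 : dist w (par w) <= 1 by rewrite dist_adj ?par_adj.
have w1s : par w \notin s.
  apply/negP => w1s; have := root0 w ws; rewrite -root_par // root_id // => E.
  by move: dw; rewrite -E; lia.
have d2 : dist (par w) (par (par w)) <= 1 by rewrite dist_adj ?par_adj.
have tr := dist_triangle conn w (par w) (par (par w)).
set z := par (par w) in d2 tr *.
have zs : z \notin s.
  apply/negP => zs; have := root0 _ w1s; rewrite -root_par // root_id // => E.
  by move: dw; rewrite -E -/z; lia.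
exists z; split=> //; first exact: internal_par.
- have az1 : anc z (par w) by rewrite anc_step // anc_refl ?orbT.
  have azw : anc z w by rewrite anc_step // az1 orbT.
  have lz := par_lev w1s; have lw := par_lev ws.
  have sub : z |: (par w |: [set w]) \subset subtree z.
    by rewrite !subUset !sub1set !inE anc_refl // az1 azw.
  apply: leq_trans (subset_leq_card sub); rewrite !cardsU1 !inE cards1.
  have -> : par w == w = false by apply/negP => /eqP E; rewrite E ltnn in lw.
  have -> : z == par w = false by apply/negP => /eqP E; rewrite -/z E ltnn in lz.
  have -> : z == w = false by apply/negP => /eqP E; move: lz; rewrite -/z E ltnNge ltnW.
  by [].
- rewrite -(card_uniqP s_uniq) subset_leq_card //; apply/subsetP => x xs.
  by rewrite !inE anc_mem.
(* Now the complement of the subtree is the cycle alone, so the only possible child of a cycle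
   vertex is [z], which is internal. *)
move=> cg; have sE : [set x in s] = ~: subtree z.
  apply/eqP; rewrite eqEcard cg cardsE (card_uniqP s_uniq) leqnn andbT.
  by apply/subsetP => x; rewrite !inE => xs; rewrite anc_mem.
rewrite -{1}(card_uniqP s_uniq) subset_leq_card //; apply/subsetP => x xs.
rewrite inE xs; apply/forallP => y; apply/implyP => ys; apply/implyP => /eqP yx.
have : y \notin [set x in s] by rewrite inE.
rewrite sE !inE negbK anc_step // yx (anc_mem _ xs) orbF => /eqP <-.
exact: internal_par.
Qed.

Theorem eds_gt_of_ecc_ge3 m : matching_number G = m -> 5 <= m -> (forall x, 3 <= ecc x) ->
  6 * #|G| ^ 2 + m ^ 2 + 9 * m * #|G| < ecc_dist_sum G + 28 * m + 22 * #|G| + 4.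
Proof.
move=> mE m5 e3; have we x : weight x <= ecc x.
  rewrite /weight; case ix: (internal x) => /=; first exact: e3.
  by have := ecc_leaf (negbT ix) (ltnW (e3 (par x))); apply: leq_ltn_trans (e3 _).
have i0 : 'I_g by apply: (Ordinal (n := g) (m := 0)); lia.
pose delta := \sum_(j < g) cycdist g i0 j.
have dE (i : 'I_g) : \sum_(j < g) cycdist g i j = delta by rewrite /delta !sum_cycdist.
have d4 : 4 * delta + odd g = g ^ 2 by rewrite /delta sum_cycdist // sum_minn_complement.
have lb := eds_lower_bound dE we.
have R1 := hung_unsupported; have L1 := hung_le_leaves; have h0 := hung0.
have hg : hung <= g by rewrite -[X in _ <= X]card_ord max_card.
have cov : 2 * m + #|unsupported| <= 2 * #|I| by rewrite -mE half_cover_tree.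
have Rg : #|unsupported| <= g.
  by rewrite -[X in _ <= X](card_uniqP s_uniq) subset_leq_card //; apply/subsetP => x; rewrite inE => /andP[].
have mn : 2 * m <= #|G| by rewrite -mE matching_half.
have nkl : #|I| + #|~: I| = #|G| by rewrite cardsC.
have gk : g <= #|I| by rewrite -sum_inner_at leq_addl.
have ex : hung = 1 -> g <= 5 -> exists a b, a + b = #|G| /\ 3 <= a /\ g <= b /\
    (a - 2) * (6 * b - 13) <= \sum_(z | (z \notin s) && internal z) excess z /\
    (b = g -> g <= #|unsupported|).
  move=> h1 g5; have [z [zs iz a3 gb br]] := deep_subtree h1 g5 e3.
  exists #|subtree z|, #|~: subtree z|; rewrite cardsC; do 4!split=> //.
  by rewrite (bigD1 z) ?zs //= leq_addr.
have g3 := s_size.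
rewrite -nkl in mn ex *.
clear dE we e3 mE; clearbody delta; clear i0 nkl.
move: lb R1 L1 h0 hg cov Rg mn gk ex d4 g3 m5; rewrite -/unsupported.
move: (\sum_(z | _) _) (ecc_dist_sum G) #|unsupported| hung #|I| #|~: I| delta g => Z xi R p k L d q.
move=> lb R1 L1 h0 hg cov Rg mn gk ex d4 g3 m5.
have [K kE] : exists K, k = q + K by exists (k - q); lia.
rewrite kE addKn in lb *; rewrite !expnS !expn0 !muln1 in d4 *; rewrite mulnA.
apply: (@cycle_arith_nat m K L q p d R Z xi) => //.
- by rewrite -kE.
- by rewrite -kE.
- by move=> p0; have [] := h0 p0; lia.
- by rewrite -kE.
Qed.

End HangingTrees.

(** * Recognizing [attach] *)

Section AttachIsomorphism.
Variables (G H : sgraph) (h : H) (f : H -> G) (P Q : {set G}) (ch : G -> G).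
Hypotheses (f_inj : injective f) (f_adj : forall x y, adj (f x) (f y) = adj x y).
Hypotheses (fP : forall x, f x \notin P) (fQ : forall x, f x \notin Q).
Hypothesis PQ : [disjoint P & Q].
Hypotheses (ch_inj : {in Q &, injective ch}) (ch_f : forall y x, y \in Q -> ch y != f x).
Hypotheses (chP : forall y, y \in Q -> ch y \notin P) (chQ : forall y, y \in Q -> ch y \notin Q).
Hypothesis cardG : #|G| = #|H| + #|P| + 2 * #|Q|.
Hypothesis adjPw : forall v w, v \in P -> adj v w = (w == f h).
Hypothesis adjQw : forall v w, v \in Q -> adj v w = (w == f h) || (w == ch v).
Hypothesis adjCw : forall v w, v \in Q -> adj (ch v) w = (w == v).

Let phi (x : attach h #|P| #|Q|) : G :=
  match x with
  | inl x => f x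
  | inr (inl i) => enum_val i
  | inr (inr (j, far)) => if far then ch (enum_val j) else enum_val j
  end.

Let eP (i : 'I_#|P|) : enum_val i \in P. Proof. exact: enum_valP. Qed.
Let eQ (i : 'I_#|Q|) : enum_val i \in Q. Proof. exact: enum_valP. Qed.

Let neqPQ x y : x \in P -> y \in Q -> (x == y) = false.
Proof. by move=> xP yQ; apply: contraTF PQ => /eqP E; apply/pred0Pn; exists x; rewrite /= xP E. Qed.

Let neq_notin (A : {set G}) x y : x \in A -> y \notin A -> (x == y) = false.
Proof. by move=> xA yA; apply: contraNF yA => /eqP <-. Qed.

Let phi_inj : injective phi.
Proof.
move=> [x|[i|[i [|]]]] [y|[j|[j [|]]]] //= E.
- by rewrite (f_inj E).
- by have := fP x; rewrite E eP.
- by have := ch_f x (eQ j); rewrite E eqxx.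
- by have := fQ x; rewrite E eQ.
- by have := fP y; rewrite -E eP.
- by rewrite (enum_val_inj E).
- by have := chP (eQ j); rewrite -E eP.
- by have := neqPQ (eP i) (eQ j); rewrite E eqxx.
- by have := ch_f y (eQ i); rewrite E eqxx.
- by have := chP (eQ i); rewrite E eP.
- by rewrite (enum_val_inj (ch_inj (eQ i) (eQ j) E)).
- by have := chQ (eQ i); rewrite E eQ.
- by have := fQ y; rewrite -E eQ.
- by have := neqPQ (eP j) (eQ i); rewrite E eqxx.
- by have := chQ (eQ j); rewrite -E eQ.
- by rewrite (enum_val_inj E).
Qed.

Let phi_adj x y : adj (phi x) (phi y) = adj x y.
Proof.
have fch y' x' : y' \in Q -> (f x' == ch y') = false by move=> yQ; rewrite eq_sym (negPf (ch_f x' yQ)).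
have Pf (i : 'I_#|P|) x' : (enum_val i == f x') = false by apply: neq_notin (eP i) (fP x').
have Qf (i : 'I_#|Q|) x' : (enum_val i == f x') = false by apply: neq_notin (eQ i) (fQ x').
have fQ' (i : 'I_#|Q|) x' : (f x' == enum_val i) = false by rewrite eq_sym Qf.
have Qch (i j : 'I_#|Q|) : (enum_val i == ch (enum_val j)) = false by apply: neq_notin (eQ i) (chQ (eQ j)).
have Pch (i : 'I_#|P|) (j : 'I_#|Q|) : (enum_val i == ch (enum_val j)) = false.
  by apply: neq_notin (eP i) (chP (eQ j)).
case: x y => [x|[i|[i [|]]]] [y|[j|[j [|]]]] /=.
- exact: f_adj.
- by rewrite adj_sym adjPw // (inj_eq f_inj).
- by rewrite adj_sym adjCw // fQ' andbF.
- by rewrite adj_sym adjQw // fch // orbF (inj_eq f_inj) andbT.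
- by rewrite adjPw // (inj_eq f_inj).
- by rewrite adjPw // Pf.
- by rewrite adjPw // (negPf (ch_f _ _)).
- by rewrite adjPw // Qf.
- by rewrite adjCw // fQ' andbF.
- by rewrite adjCw // neqPQ.
- by rewrite adjCw // eq_sym Qch andbF.
- by rewrite adjCw // (inj_eq enum_val_inj) eq_sym andbT.
- by rewrite adjQw // fch // orbF (inj_eq f_inj) andbT.
- by rewrite adjQw // Pf Pch.
- rewrite adjQw // (negPf (ch_f _ _)) //= (inj_in_eq ch_inj) //.
  by rewrite (inj_eq enum_val_inj) eq_sym andbT.
- by rewrite adjQw // Qf Qch andbF.
Qed.

(** By [cardG] the injection [phi] runs between sets of equal size, so it is a bijection; the three
    neighbourhood hypotheses fix every adjacency outside the copy of [H]. *)
Lemma attach_iso : isomorphic G (attach h #|P| #|Q|).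
Proof.
have card_att : #|attach h #|P| #|Q| | = #|G|.
  by rewrite cardG !card_sum card_prod !card_ord card_bool; lia.
have [psi phiK psiK] : bijective phi.
  by apply: (inj_card_bij phi_inj); rewrite card_att.
by exists psi => [|x y]; [exists phi|rewrite -phi_adj !psiK].
Qed.

End AttachIsomorphism.

Lemma isomorphic_sym (G H : sgraph) : isomorphic G H -> isomorphic H G.
Proof.
case=> f [g fK gK] fadj; exists g; first by exists f.
by move=> x y; rewrite -fadj !gK.
Qed.

Lemma vertex_cover (G : sgraph) (W : {set G}) :
  (forall x y, adj x y -> (x \in W) || (y \in W)) -> matching_number G <= #|W|.
Proof.
move=> cov; rewrite -(leq_pmul2l (m := 2)) //.
apply: leq_trans (half_cover (phi := fun x => 2 * (x \in W)) _) _.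
  by move=> x y /cov; case: (x \in W); case: (y \in W).
by rewrite -big_distrr /= leq_mul2l /= -sum1_card [X in _ <= X]big_mkcond.
Qed.

(** * A vertex of eccentricity at most 2: a tree of depth 2 plus an edge *)

Section TwoLevels.
Variables (G : sgraph) (c : G) (par : G -> G).
Hypothesis Guni : unicyclic G.
Hypothesis parP : parent_to [set c] (fun x => dist x c) par.
Hypothesis ecc2 : forall x, dist x c <= 2.
Implicit Types x y z u v w : G.

Let conn : connected G := proj1 Guni.

Definition lev x := dist x c.
Definition near := [set x | lev x == 1].
Definition far := [set x | lev x == 2].
Definition branch x := if x \in far then par x else x.

Lemma lev0 x : lev x = 0 -> x = c.
Proof. exact: dist_eq0. Qed.

Lemma levc : lev c = 0.
Proof. exact: distxx. Qed.

Lemma par_adj1 x : x != c -> adj x (par x).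
Proof. by move=> xc; have [|] := parP (x := x) _; rewrite ?inE. Qed.

Lemma par_lev1 x : x != c -> lev (par x) < lev x.
Proof. by move=> xc; have [|] := parP (x := x) _; rewrite ?inE. Qed.

Lemma lev_adj x y : adj x y -> lev x <= (lev y).+1.
Proof.
move=> xy; apply: leq_trans (dist_triangle conn x y c) _.
by rewrite -add1n leq_add2r dist_adj.
Qed.

Lemma near_par x : x \in near -> par x = c.
Proof.
rewrite inE => /eqP lx; apply: lev0; have xc : x != c by apply: contra_eq_neq lx => ->; rewrite levc.
by have := par_lev1 xc; lia.
Qed.

Lemma near_neq x : x \in near -> x != c.
Proof. by rewrite inE; apply: contraTneq => ->; rewrite levc. Qed.

Lemma far_neq x : x \in far -> x != c.
Proof. by rewrite inE; apply: contraTneq => ->; rewrite levc. Qed.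

Lemma far_par x : x \in far -> par x \in near.
Proof.
move=> xf; have xc := far_neq xf; move: xf; rewrite !inE => /eqP lx.
by have := par_lev1 xc; have := lev_adj (par_adj1 xc); lia.
Qed.

Lemma vertex_cases x : [\/ x = c, x \in near | x \in far].
Proof.
rewrite !inE; have := ecc2 x; rewrite -/(lev x).
case E: (lev x) => [|[|[|]]] // _; [constructor 1|constructor 2|constructor 3] => //.
exact: lev0.
Qed.

Lemma branchc : branch c = c.
Proof. by rewrite /branch inE levc. Qed.

Lemma branch_near x : x \in near -> branch x = x.
Proof. by rewrite /branch !inE => /eqP ->. Qed.

Lemma branch_far x : x \in far -> branch x = par x.
Proof. by rewrite /branch => ->. Qed.

Lemma branch_in x : x != c -> branch x \in near.
Proof.
case: (vertex_cases x) => [->|xn _|xf _]; rewrite ?eqxx //; first by rewrite branch_near.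
by rewrite branch_far // far_par.
Qed.

Lemma branch_eqc x : (branch x == c) = (x == c).
Proof.
apply/eqP/eqP => [bc|->]; last exact: branchc.
by apply/eqP; apply: contraT => /branch_in; rewrite bc inE levc.
Qed.

(* [tdist] is the distance in the spanning tree given by [par]. *)
Definition overlap u v : nat := (u != c) && (branch u == branch v).
Definition samefar u v : nat := (u == v) && (u \in far).
Definition tdist u v := lev u + lev v - 2 * overlap u v - 2 * samefar u v.

Lemma lev_gt0 x : x != c -> 0 < lev x.
Proof. by case: (posnP (lev x)) => // /lev0 ->; rewrite eqxx. Qed.

(** [overlap u v + samefar u v] is the depth of the lowest common ancestor of [u] and [v]. In this
    additive form no subtraction is truncated. *)
Lemma tdistE u v : tdist u v + 2 * overlap u v + 2 * samefar u v = lev u + lev v.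
Proof.
rewrite /tdist /samefar; case: (eqVneq u v) => [<-|uv] /=.
  rewrite /overlap eqxx andbT; case: (eqVneq u c) => [->|uc] /=; first by rewrite inE levc.
  by rewrite inE; have := lev_gt0 uc; case: eqP; lia.
rewrite /overlap; case: (eqVneq u c) => [->|uc] /=; first lia.
case: eqP => /= [E|]; last lia.
have vc : v != c by rewrite -branch_eqc -E branch_eqc.
by have := lev_gt0 uc; have := lev_gt0 vc; lia.
Qed.

Lemma overlapC u v : overlap u v = overlap v u.
Proof.
rewrite /overlap (eq_sym (branch v)); case: (branch u =P branch v) => [E|]; rewrite ?andbF ?andbT //.
by rewrite -branch_eqc E branch_eqc.
Qed.

Lemma samefarC u v : samefar u v = samefar v u.
Proof. by rewrite /samefar eq_sym; case: eqP => [->|]. Qed.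

Lemma tdistC u v : tdist u v = tdist v u.
Proof. by rewrite /tdist overlapC samefarC [lev u + _]addnC. Qed.

Lemma tdistxx u : tdist u u = 0.
Proof.
have := tdistE u u; rewrite /overlap /samefar !eqxx andbT inE /=.
have [->|uc] := eqVneq u c; first by rewrite levc; lia.
by have := lev_gt0 uc; have := ecc2 u; rewrite -/(lev u); case: eqP; lia.
Qed.

Lemma tdist_par u v : v != c -> tdist u v <= (tdist u (par v)).+1 /\ tdist u (par v) <= (tdist u v).+1.
Proof.
move=> vc; have := tdistE u v; have := tdistE u (par v).
have [vn|vf] : v \in near \/ v \in far by case: (vertex_cases v) vc => [->|//|]; [rewrite eqxx|left|right].
  have pc := near_par vn; rewrite pc levc.
  have -> : overlap u c = 0 by rewrite overlapC /overlap eqxx.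
  have -> : samefar u c = 0 by rewrite samefarC /samefar inE levc andbF.
  have -> : samefar u v = 0.
    by rewrite samefarC /samefar; move: vn; rewrite !inE => /eqP ->; rewrite andbF.
  have : overlap u v <= 1 by rewrite /overlap; case: (_ && _).
  by move: vn; rewrite inE => /eqP ->; lia.
have pn := far_par vf.
have -> : overlap u (par v) = overlap u v by rewrite /overlap (branch_far vf) (branch_near pn).
have -> : samefar u (par v) = 0.
  by rewrite samefarC /samefar; move: pn; rewrite !inE => /eqP ->; rewrite andbF.
have : samefar u v <= 1 by rewrite /samefar; case: (_ && _).
by move: pn vf; rewrite !inE => /eqP -> /eqP ->; lia.
Qed.

(** * Summing the tree distances *)

Definition kids x := [set y in far | par y == x].
(** A lower bound for the eccentricity once three vertices at depth 1 have children, see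
    [wt_le_ecc]. *)
Definition wt u := 2 + lev u.
Local Notation k := #|near|.
Local Notation s := #|far|.
Definition sumsq := \sum_(x in near) #|kids x| ^ 2.

Lemma sum_levels (F : G -> nat) :
  \sum_u F u = F c + \sum_(u in near) F u + \sum_(u in far) F u.
Proof.
rewrite (bigD1 c) //= -addnA; congr (_ + _); rewrite (bigID [in near]) /=.
congr (_ + _); apply: eq_bigl => u.
  by case un: (u \in near); rewrite ?andbF // andbT; apply: near_neq.
case: (vertex_cases u) => [->|un|uf]; first by rewrite eqxx !inE levc.
  by rewrite un andbF; move: un; rewrite !inE => /eqP ->.
by rewrite far_neq // uf; move: uf; rewrite !inE => /eqP ->.
Qed.

Lemma card_levels : #|G| = 1 + k + s.
Proof.
transitivity (\sum_(u : G) 1); first by rewrite sum1_card.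
by rewrite sum_levels !sum1_card.
Qed.

Lemma sum_lev (f : nat -> nat) : \sum_u f (lev u) = f 0 + k * f 1 + s * f 2.
Proof.
rewrite sum_levels levc -!sum_nat_const; congr (_ + _ + _);
by apply: eq_bigr => u; rewrite inE => /eqP ->.
Qed.

Lemma sum_far (F : G -> nat) : \sum_(y in far) F y = \sum_(x in near) \sum_(y in kids x) F y.
Proof.
rewrite (partition_big par [in near]) /=; last exact: far_par.
by apply: eq_bigr => x _; apply: eq_bigl => y; rewrite [RHS]inE.
Qed.

Lemma sum_kids : \sum_(x in near) #|kids x| = s.
Proof. by rewrite -sum1_card sum_far; apply: eq_bigr => x _; rewrite sum1_card. Qed.

Definition limb x := x |: kids x.

Lemma kids_self x : x \in near -> x \notin kids x.
Proof. by rewrite !inE => /eqP ->. Qed.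

Lemma sum_limb (F : G -> nat) x : x \in near ->
  \sum_(u in limb x) F u = F x + \sum_(u in kids x) F u.
Proof. by move=> xn; rewrite big_setU1 ?kids_self. Qed.

Lemma card_limb x : x \in near -> #|limb x| = 1 + #|kids x|.
Proof. by move=> xn; rewrite cardsU1 kids_self. Qed.

Lemma wt_limb x : x \in near -> \sum_(u in limb x) wt u = 3 + 4 * #|kids x|.
Proof.
move=> xn; rewrite sum_limb // mulnC -sum_nat_const; congr (_ + _).
  by move: xn; rewrite /wt inE => /eqP ->.
by apply: eq_bigr => u; rewrite /wt !inE => /andP[/eqP ->].
Qed.

Lemma limbP x u : x \in near -> (u \in limb x) = (u != c) && (branch u == x).
Proof.
move=> xn; rewrite in_setU1; case: (vertex_cases u) => [->|un|uf].
- by rewrite eqxx /= inE inE levc /= orbF; apply/eqP => cx; have := near_neq xn; rewrite -cx eqxx.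
- rewrite near_neq // branch_near //= inE.
  by move: un; rewrite !inE => /eqP ->; rewrite orbF.
rewrite far_neq // branch_far // inE uf /=; case: eqP => //= ux.
by move: uf xn; rewrite ux !inE => /eqP ->.
Qed.

Lemma sum_limbs (F : G -> nat) :
  \sum_(u | u != c) F u = \sum_(x in near) \sum_(u in limb x) F u.
Proof.
rewrite (partition_big branch [in near]) /=; last exact: branch_in.
by apply: eq_bigr => x xn; apply: eq_bigl => u; rewrite limbP.
Qed.

(** Sum [tdistE]: the levels give the right-hand side, [overlap] gives [(3 + 4 d) (1 + d)] for each
    vertex at depth 1 with [d] children, and [samefar] gives the weight 4 for each vertex at depth
    2. *)
Lemma tdist_sum :
  \sum_u \sum_v wt u * tdist u v + 2 * (3 * k + 7 * s + 4 * sumsq) + 8 * s =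
  (1 + k + s) * (3 * k + 8 * s) + (2 + 3 * k + 4 * s) * (k + 2 * s).
Proof.
have Eo : \sum_u \sum_v wt u * overlap u v = 3 * k + 7 * s + 4 * sumsq.
  transitivity (\sum_(u | u != c) wt u * #|limb (branch u)|).
    rewrite [RHS]big_mkcond; apply: eq_bigr => u _; rewrite -big_distrr /=.
    case: ifPn => uc; last by rewrite big1 ?muln0 // => v _; rewrite /overlap (negPf uc).
    congr (_ * _); rewrite -sum1_card [RHS]big_mkcond; apply: eq_bigr => v _.
    rewrite overlapC limbP ?branch_in //.
  rewrite sum_limbs (eq_bigr (fun x => (3 + 4 * #|kids x|) * (1 + #|kids x|))); last first.
    move=> x xn; rewrite -wt_limb // big_distrl; apply: eq_bigr => u; rewrite limbP //.
    by case/andP=> _ /eqP ->; rewrite card_limb.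
  rewrite -sum_kids /sumsq -sum1_card !big_distrr -!big_split /=; apply: eq_bigr => x _.
  by rewrite !expnS expn0; nia.
have Es : \sum_u \sum_v wt u * samefar u v = 4 * s.
  rewrite mulnC -sum_nat_const [RHS]big_mkcond; apply: eq_bigr => u _; rewrite -big_distrr /=.
  rewrite (bigD1 u) //= big1 => [|v vu]; last by rewrite /samefar eq_sym (negPf vu).
  by rewrite /samefar eqxx /wt inE; case: eqP => [->|]; rewrite ?muln0.
have El : \sum_u \sum_v wt u * (lev u + lev v) =
  (1 + k + s) * (3 * k + 8 * s) + (2 + 3 * k + 4 * s) * (k + 2 * s).
  transitivity (\sum_u (#|G| * (wt u * lev u) + wt u * \sum_v lev v)).
    apply: eq_bigr => u _; rewrite -big_distrr /= big_split /=.
    have -> : \sum_(v : G) lev u = #|G| * lev u by rewrite sum_nat_const.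
    by rewrite [LHS]mulnDr [wt u * (_ * _)]mulnCA.
  rewrite big_split -big_distrr -big_distrl /= (sum_lev (fun l => (2 + l) * l)).
  rewrite (sum_lev (fun l => 2 + l)) (sum_lev id) card_levels; lia.
rewrite -El -Eo; have -> : 8 * s = 2 * (4 * s) by lia.
rewrite -Es !big_distrr -!big_split; apply: eq_bigr => u _ /=.
rewrite !big_distrr -!big_split; apply: eq_bigr => v _ /=.
by rewrite -tdistE; lia.
Qed.

Lemma product_sum (e : G -> nat) (P Q : {set G}) :
  \sum_u \sum_v e u * ((u \in P) * (v \in Q) + (v \in P) * (u \in Q)) =
  (\sum_(u in P) e u) * #|Q| + (\sum_(u in Q) e u) * #|P|.
Proof.
have H (A B : {set G}) : \sum_u \sum_v e u * ((u \in A) * (v \in B)) = (\sum_(u in A) e u) * #|B|.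
  rewrite [X in _ = X * _]big_mkcond big_distrl; apply: eq_bigr => u _ /=.
  rewrite -sum1_card [X in _ = _ * X]big_mkcond big_distrr; apply: eq_bigr => v _ /=.
  by case: (u \in A); case: (v \in B); rewrite ?muln0 ?muln1.
rewrite -!H -big_split; apply: eq_bigr => u _; rewrite -big_split; apply: eq_bigr => v _ /=.
by rewrite mulnDr [(v \in P) * _]mulnC.
Qed.

(** * Shortcuts through the extra edge *)

Variables a b : G.
Hypotheses (ab : adj a b) (nab : ~ (a != c /\ b = par a)) (nba : ~ (b != c /\ a = par b)).
Hypothesis adjP : forall x y, adj x y -> [\/ x != c /\ y = par x, y != c /\ x = par y,
  x = a /\ y = b | x = b /\ y = a].

(** All neighbours of [c] are at depth 1 and have [c] as parent, so every edge at [c] is a tree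
    edge. *)
Lemma extra_neq : a != c /\ b != c.
Proof.
have H x y : adj x y -> y = c -> x != c /\ y = par x.
  move=> xy yc; have xn : x \in near.
    rewrite inE; have := lev_adj xy; rewrite yc levc; case: (posnP (lev x)) => [/lev0 xc|]; last by lia.
    by move: xy; rewrite xc yc adj_irrefl.
  by rewrite near_neq // near_par.
split; apply/negP => /eqP e.
  by apply: nba; apply: H => //; rewrite adj_sym.
exact/nab/H.
Qed.

Lemma lev_ge_tdist u v : lev v <= tdist u v + lev u.
Proof.
have := tdistE u v; rewrite /overlap /samefar.
case: (eqVneq u c) => [->|uc] /=; first by rewrite inE levc andbF; lia.
have := lev_gt0 uc; rewrite inE.
by case: (branch u == branch v); case: (u == v); case: (lev u =P 2) => /=; lia.
Qed.

(** The minimum over the tree walk and the two walks that cross [ab] once vanishes at [v = u] and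
    grows by at most one along each edge. *)
Lemma dist_cases u v : [\/ tdist u v <= dist u v, tdist u a + 1 + tdist b v <= dist u v |
  tdist u b + 1 + tdist a v <= dist u v].
Proof.
pose f w := minn (tdist u w) (minn (tdist u a + 1 + tdist b w) (tdist u b + 1 + tdist a w)).
suff : f v <= dist u v by rewrite /f !geq_min => /orP[|/orP[]] ?; [constructor 1|constructor 2|constructor 3].
have := @dist_lipschitz _ conn f u v; have -> : f u = 0 by rewrite /f tdistxx min0n.
apply=> x y /adjP[[xc ->]|[yc ->]|[-> ->]|[-> ->]]; rewrite /f.
- by have := tdist_par u xc; have := tdist_par a xc; have := tdist_par b xc; lia.
- by have := tdist_par u yc; have := tdist_par a yc; have := tdist_par b yc; lia.
- by rewrite !tdistxx (tdistC b a); lia.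
- by rewrite !tdistxx (tdistC b a); lia.
Qed.

(** If [u] is outside the branch of [a], then [tdist u a = lev u + lev a]; as [lev b <= lev a + 1],
    the detour through [ab] is at least [lev u + lev v]. The same holds with [v] and [b]. *)
Lemma tdist_off u v : ~~ ((branch u == branch a) && (branch v == branch b)) ->
  tdist u v <= tdist u a + 1 + tdist b v.
Proof.
have [ac bc] := extra_neq.
have la := lev_adj ab; have lb : lev b <= (lev a).+1 by apply: lev_adj; rewrite adj_sym.
have le : tdist u v <= lev u + lev v by rewrite -tdistE -addnA leq_addr.
rewrite negb_and => /orP[ua|vb].
  have := tdistE u a; rewrite /overlap (negPf ua) andbF /samefar.
  have -> : (u == a) = false by apply: contraNF ua => /eqP ->.
  by have := lev_ge_tdist b v; lia.
have := tdistE b v; rewrite /overlap (eq_sym (branch b)) (negPf vb) andbF /samefar.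
have -> : (b == v) = false by apply: contraNF vb => /eqP ->.
by have := lev_ge_tdist a u; rewrite tdistC; lia.
Qed.

(* Only pairs in the branches of a and b can use the edge ab; rho u v bounds what u gains
   by walking to v through a first and then b. *)
Lemma tdist_red (rho : G -> G -> nat) u v :
  (forall u v, branch u = branch a -> branch v = branch b ->
     tdist u v <= tdist u a + 1 + tdist b v + rho u v) ->
  tdist u v <= dist u v + rho u v + rho v u.
Proof.
move=> H; have K u' v' : tdist u' v' <= tdist u' a + 1 + tdist b v' + rho u' v'.
  have [/andP[/eqP ua /eqP vb]|off] := boolP ((branch u' == branch a) && (branch v' == branch b)).
    exact: H.
  by apply: leq_trans (tdist_off off) (leq_addr _ _).
have := K u v; have := K v u; rewrite (tdistC v u) (tdistC v a) (tdistC b u).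
by case: (dist_cases u v); lia.
Qed.

Lemma dist_ge_tdist u v : ~~ ((branch u == branch a) && (branch v == branch b)) ->
  ~~ ((branch u == branch b) && (branch v == branch a)) -> tdist u v <= dist u v.
Proof.
move=> h1 h2; have := tdist_off h1; have := @tdist_off v u; rewrite andbC => /(_ h2).
rewrite (tdistC v u) (tdistC v a) (tdistC b u).
by case: (dist_cases u v); lia.
Qed.

(** * Covers and eccentricities *)

Definition supp := [set x in near | 0 < #|kids x|].
Local Notation t := #|supp|.

Lemma supp_par y : y \in far -> par y \in supp.
Proof.
by move=> yf; rewrite inE far_par //=; apply/card_gt0P; exists y; rewrite inE yf eqxx.
Qed.

(** A tree edge either contains [c] or joins a vertex at depth 2 to its parent. *)
Lemma cover_parents (W : {set G}) :
  c \in W -> (forall y, y \in far -> (par y \in W) || (y \in W)) -> (a \in W) || (b \in W) ->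
  matching_number G <= #|W|.
Proof.
move=> cW fW abW; apply: vertex_cover => x y.
have H z : z != c -> (z \in W) || (par z \in W).
  by case: (vertex_cases z) => [->|zn _|zf _]; [rewrite eqxx|rewrite near_par // cW orbT|rewrite orbC fW].
by case/adjP=> [[xc ->]|[yc ->]|[-> ->]|[-> ->]]; rewrite ?H // orbC ?H.
Qed.

Lemma matching_le2 : matching_number G <= t + 2.
Proof.
have -> := leq_trans (cover_parents (W := c |: (a |: supp)) _ _ _) _ => //.
- by rewrite setU11.
- by move=> y yf; rewrite !in_setU1 supp_par ?orbT.
- by rewrite !in_setU1 eqxx orbT.
by rewrite addn2 !cardsU1; do 2 case: (_ \notin _) => //=; lia.
Qed.

Lemma matching_le1 : (a \in supp) || (b \in supp) -> matching_number G <= t + 1.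
Proof.
move=> abs; have -> := leq_trans (cover_parents (W := c |: supp) _ _ _) _ => //.
- by rewrite setU11.
- by move=> y yf; rewrite !in_setU1 supp_par ?orbT.
- by rewrite !in_setU1 orbACA abs orbT.
by rewrite cardsU1; case: (_ \notin _); lia.
Qed.

(** An only child [y] can replace its parent in the cover: it covers the edge to the parent and also
    the extra edge. *)
Lemma matching_le1_single y : y = a \/ y = b -> y \in far -> #|kids (par y)| = 1 ->
  matching_number G <= t + 1.
Proof.
move=> yab yf k1; have -> := leq_trans (cover_parents (W := c |: (y |: (supp :\ par y))) _ _ _) _ => //.
- by rewrite setU11.
- move=> z zf; rewrite !in_setU1 in_setD1 supp_par // andbT.
  case: (eqVneq (par z) (par y)) => [zy|]; rewrite ?orbT //=.
  have /eqP/cards1P[w kw] := k1.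
  have := set11 w; have : z \in kids (par y) by rewrite inE zf zy eqxx.
  have : y \in kids (par y) by rewrite inE yf eqxx.
  by rewrite kw !inE => /eqP -> /eqP ->; rewrite eqxx !orbT.
- by case: yab => ->; rewrite !in_setU1 eqxx !orbT.
rewrite !cardsU1 (cardsD1 (par y) supp) supp_par //.
by case: (_ \notin _); case: (_ \notin _); lia.
Qed.

Lemma wt_le_ecc u : 3 <= t -> wt u <= ecc u.
Proof.
move=> t3.
(* A child of a vertex in [supp] outside the branches [branch u] and [w1] forms with [u] a pair to
   which [ab] opens no shortcut; its tree distance from [u] is [lev u + 2]. *)
pose w1 := if branch u == branch a then branch b else branch a.
have [x] : exists x, x \in supp :\: [set branch u; w1].
  apply/set0Pn; rewrite -card_gt0 cardsD subn_gt0; apply: leq_ltn_trans t3.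
  apply: leq_trans (subset_leq_card (subsetIr _ _)) _.
  by rewrite cards2; case: (_ != _).
rewrite !inE negb_or => /andP[/andP[xu xw] /andP[xn /card_gt0P[v]]]; rewrite inE => /andP[vf /eqP vx].
have bv : branch v = x by rewrite branch_far.
apply: leq_trans (ecc_le u v); rewrite (dist_sym conn).
apply: (@leq_trans (tdist u v)); last apply: dist_ge_tdist.
- have := tdistE u v; rewrite /overlap bv (eq_sym (branch u)) (negPf xu) andbF.
  have -> : samefar u v = 0.
    by rewrite /samefar; case: eqP => // uv; move: xu; rewrite uv bv eqxx.
  by move: vf; rewrite /wt inE => /eqP ->; lia.
- by move: xw; rewrite bv /w1; case: ifP => //= _.
- move: xw; rewrite bv /w1; case: ifP => [/eqP ua _|_ /negPf ->]; last by rewrite andbF.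
  by rewrite -ua (negPf xu) andbF.
Qed.

(** * Children beyond the first *)

Definition spare x := #|kids x|.-1.
Local Notation e := (s - t).
Local Notation Q := (\sum_(x in near) spare x ^ 2).

Lemma in_kids x y : (y \in kids x) = (y \in far) && (par y == x).
Proof. by rewrite [LHS]inE. Qed.

Lemma supp_kids x : x \in near -> (x \in supp) = (0 < #|kids x|).
Proof. by move=> xn; rewrite inE xn. Qed.

Lemma sum_supp : \sum_(x in near) (x \in supp : nat) = t.
Proof.
rewrite -sum1_card big_mkcond [RHS]big_mkcond; apply: eq_bigr => x _.
by rewrite [x \in supp]inE; case: (x \in near); case: (0 < _).
Qed.

Lemma sum_spare : s = t + \sum_(x in near) spare x.
Proof.
rewrite -sum_kids -sum_supp -big_split; apply: eq_bigr => x xn /=.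
by rewrite supp_kids // /spare; case: #|kids x|.
Qed.

Lemma spare_total : \sum_(x in near) spare x = e.
Proof. by rewrite sum_spare addKn. Qed.

Lemma supp_le_far : t <= s.
Proof. by rewrite sum_spare leq_addr. Qed.

Lemma sumsq_spare : sumsq = t + 2 * e + Q.
Proof.
rewrite -spare_total -sum_supp /sumsq big_distrr -!big_split; apply: eq_bigr => x xn /=.
by rewrite supp_kids // /spare !expnS !expn0; case: #|kids x| => //= j; nia.
Qed.

Lemma sqr_sum (I : finType) (P : pred I) (f : I -> nat) :
  \sum_(i | P i) f i ^ 2 <= (\sum_(i | P i) f i) ^ 2.
Proof.
elim/big_rec2: _ => // i x y _ IH; apply: leq_trans (leq_add (leqnn _) IH) _.
by rewrite sqrnD leq_addr.
Qed.

Lemma spare_sqr : Q <= e ^ 2.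
Proof. by rewrite -spare_total; apply: sqr_sum. Qed.

Lemma spare_le x : x \in near -> spare x <= e.
Proof. by move=> xn; rewrite -spare_total (bigD1 x) //= leq_addr. Qed.

(** In the square of the sum of all [spare], keep the squares and the one cross term of [x] and
    [y]. *)
Lemma spare_pair x y : x \in near -> y \in near -> x != y ->
  spare x + spare y <= e /\ Q + 2 * (spare x * spare y) <= e ^ 2.
Proof.
move=> xn yn xy; rewrite -spare_total !(bigD1 (P := [in near]) x) //=.
rewrite !(bigD1 (P := fun i => (i \in near) && (i != x)) y) ?yn 1?eq_sym //=.
have := sqr_sum (fun i => (i \in near) && (i != x) && (i != y)) spare.
move: (\sum_(i | _) spare i ^ 2) (\sum_(i | _) spare i) (spare x) (spare y) => X S p q.
by rewrite !expnS !expn0; split; nia.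
Qed.

Lemma supp_near : t <= k.
Proof. by rewrite subset_leq_card //; apply/subsetP => x; rewrite inE => /andP[]. Qed.

Lemma supp_near1 x : x \in near -> x \notin supp -> t + 1 <= k.
Proof.
move=> xn xs; rewrite addn1 -add1n; apply: leq_trans (_ : #|x |: supp| <= _).
  by rewrite cardsU1 xs.
rewrite subset_leq_card //; apply/subsetP => y; rewrite !inE => /orP[/eqP->|/andP[]//].
by move: xn; rewrite inE.
Qed.

Lemma supp_near2 x y : x \in near -> y \in near -> x != y -> x \notin supp -> y \notin supp ->
  t + 2 <= k.
Proof.
move=> xn yn xy xs ys; apply: leq_trans (_ : #|x |: (y |: supp)| <= _).
  by rewrite !cardsU1 ys in_setU1 negb_or xy xs; lia.
rewrite subset_leq_card //; apply/subsetP => z; rewrite !in_setU1 => /orP[/eqP->//|/orP[/eqP->//|]].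
by rewrite inE => /andP[].
Qed.

Local Notation r := (k - t).
Local Notation m := (matching_number G).
Local Notation xi := (ecc_dist_sum G).

Lemma card_shift : #|G| = 1 + (t + r) + (t + e).
Proof. by rewrite card_levels; have := supp_near; have := supp_le_far; lia. Qed.

(** A pointwise bound [rho] on the shortcuts costs at most [red] in the weighted sum; [3 <= t]
    enters through [wt_le_ecc]. *)
Lemma estimate_red (rho : G -> G -> nat) red :
  (forall u v, branch u = branch a -> branch v = branch b ->
     tdist u v <= tdist u a + 1 + tdist b v + rho u v) ->
  3 <= t -> \sum_u \sum_v wt u * (rho u v + rho v u) = red ->
  estimate_nat (t + r) (t + e) (t + 2 * e + Q) red xi.
Proof.
move=> H t3 redE; have := tdist_sum; have : \sum_u \sum_v wt u * tdist u v <= xi + red.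
  apply: (@leq_trans (\sum_u \sum_v wt u * dist u v + red)); last first.
    rewrite leq_add2r; apply: leq_sum => u _; rewrite -big_distrr leq_mul ?wt_le_ecc //.
    by apply: leq_sum => v _; rewrite (dist_sym conn).
  rewrite -redE -big_split; apply: leq_sum => u _; rewrite -big_split; apply: leq_sum => v _ /=.
  by rewrite -mulnDr leq_mul2l orbC addnA tdist_red.
have -> : t + r = k by have := supp_near; lia.
have -> : t + e = s by have := supp_le_far; lia.
rewrite -sumsq_spare /estimate_nat; move: (\sum_u _) => X; lia.
Qed.

Lemma kids_spare x : x \in near -> #|kids x| <= 1 + spare x.
Proof. by rewrite /spare; case: #|kids x|. Qed.

(** * The possible depths of the ends of the extra edge *)

(** The cycle is the triangle [c], [a], [b], and pairs from the two branches gain 1. If an end has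
    children, then [m <= t + 1], so [t >= 4]; if neither has, two childless vertices at depth 1 give
    [r >= 2], and only [e = 0] with [m = t + 2] escapes. *)
Lemma case_near_near : 5 <= m -> a \in near -> b \in near ->
  bound_lt m #|G| xi \/ [/\ #|kids a| = 0, #|kids b| = 0, s = t & m = t + 2].
Proof.
move=> m5 an bn; have t3 : 3 <= t by rewrite -(leq_add2r 2); apply: leq_trans m5 matching_le2.
have anb : a != b by apply: contraTneq ab => ->; rewrite adj_irrefl.
have L := @estimate_red (fun u v => (u \in limb a) * (v \in limb b)) _ _ t3 erefl.
rewrite product_sum !wt_limb // !card_limb // in L.
have {}L : estimate_nat (t + r) (t + e) (t + 2 * e + Q)
   (6 + 7 * (#|kids a| + #|kids b|) + 8 * (#|kids a| * #|kids b|)) xi.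
  rewrite (_ : 6 + _ + _ = (3 + 4 * #|kids a|) * (1 + #|kids b|) + (3 + 4 * #|kids b|) * (1 + #|kids a|));
    last by nia.
  apply: L => u v ua va; have uc : u != c by rewrite -branch_eqc ua branch_eqc near_neq.
  have vc : v != c by rewrite -branch_eqc va branch_eqc near_neq.
  rewrite !limbP // uc vc ua va !branch_near // !eqxx.
  have := tdistE u a; have := tdistE b v; have := tdistE u v.
  rewrite /overlap uc near_neq // ua va !branch_near // !eqxx /samefar.
  move: (an) (bn); rewrite !inE => /eqP la /eqP lb; rewrite la lb andbF.
  have -> : (u == a) && (lev u == 2) = false by apply/negP => /andP[/eqP ->]; rewrite la.
  by have := lev_gt0 uc; have := lev_gt0 vc; lia.
rewrite card_shift; have [abs|] := boolP ((a \in supp) || (b \in supp)).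
  left; have m1 := matching_le1 abs; have [pe pq] := spare_pair an bn anb.
  rewrite expnS expn1 in pq.
  have t4 : 4 <= t by rewrite -(leq_add2r 1); apply: leq_trans m5 m1.
  exact: bound_lt_triangle t4 pe pq (kids_spare an) (kids_spare bn) m1 L.
rewrite negb_or => /andP[as_ bs]; have kt := supp_near2 an bn anb as_ bs.
move: as_ bs; rewrite !supp_kids // -!eqn0Ngt => /eqP ka /eqP kb.
have := spare_sqr; rewrite expnS expn1 => sq; rewrite ka kb in L.
have m2 := matching_le2; have ts := supp_le_far.
have [e0|e1] := posnP e; last first.
  by left; apply: (@bound_lt_triangle_bare _ _ _ _ Q) L; lia.
have [mt|mt] := leqP m (t + 1); last by clear -mt m2 ts e0 ka kb; right; split=> //; lia.
by left; apply: (@bound_lt_triangle_bare _ _ _ _ Q) L; lia.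
Qed.

(** Only the pair [a], [b] gains, and by 1. Their parent has two children, which gives the [e >= 1]
    required for [m = t + 2]. *)
Lemma case_far_same : 5 <= m -> a \in far -> b \in far -> par a = par b -> bound_lt m #|G| xi.
Proof.
move=> m5 af bf pab; have t3 : 3 <= t by rewrite -(leq_add2r 2); apply: leq_trans m5 matching_le2.
have anb : a != b by apply: contraTneq ab => ->; rewrite adj_irrefl.
have := @estimate_red (fun u v => (u \in [set a]) * (v \in [set b])) _ _ t3 erefl.
rewrite product_sum !big_set1 !cards1 /wt.
have -> : lev a = 2 by move: af; rewrite inE => /eqP.
have -> : lev b = 2 by move: bf; rewrite inE => /eqP.
move=> L; rewrite card_shift; apply: bound_lt_far_triangle (L _) => //.
- have := spare_le (far_par af); rewrite /spare; apply: leq_trans.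
  have : [set a; b] \subset kids (par a) by rewrite subUset !sub1set !in_kids af bf pab eqxx.
  by move/subset_leq_card; rewrite cards2 anb; lia.
- by have := spare_sqr; rewrite expnS expn1.
- exact: matching_le2.
move=> u v ua va; have [ac bc] := extra_neq.
have uc : u != c by rewrite -branch_eqc ua branch_eqc.
have vc : v != c by rewrite -branch_eqc va branch_eqc.
have := tdistE u a; have := tdistE b v; have := tdistE u v.
have bb : branch a = branch b by rewrite !branch_far.
rewrite /overlap uc bc ua va bb !eqxx /samefar !inE.
move: (af) (bf); rewrite !inE => /eqP la /eqP lb; rewrite la lb (eq_sym b).
have rb : (v == b) -> lev v = 2 by move/eqP ->.
have ra : (u == a) -> lev u = 2 by move/eqP ->.
have nuv : ~~ [&& u == a, v == b & u == v].
  by apply: contraNN anb => /and3P[/eqP <- /eqP <-].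
have := lev_gt0 uc; have := lev_gt0 vc; have := ecc2 u; have := ecc2 v; rewrite -/(lev u) -/(lev v).
move: (lev u) (lev v) (tdist u v) (tdist b v) (tdist u a) ra rb nuv => lu lv d db da; clear.
case: (u == a) => [/(_ isT) ->|_]; case: (v == b) => [/(_ isT) ->|_];
by case: (u == v) => //= _; case: (lu =P 2); case: (lv =P 2); rewrite ?andbT ?andbF /=; lia.
Qed.

(** The cycle is the square [c], [a], [b], [par b], and the branch of [a] gains 2 towards [b]. If
    [a] has children or [b] is an only child, then [m <= t + 1]; otherwise [par b] yields [e >= 1]
    and [a] yields [r >= 1]. *)
Lemma case_near_far : 5 <= m -> a \in near -> b \in far -> bound_lt m #|G| xi.
Proof.
move=> m5 an bf; have t3 : 3 <= t by rewrite -(leq_add2r 2); apply: leq_trans m5 matching_le2.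
have [ac bc] := extra_neq; have pbn := far_par bf.
have pba : par b != a by apply/eqP => E; apply: nba.
have lb : lev b = 2 by move: bf; rewrite inE => /eqP.
have la : lev a = 1 by move: an; rewrite inE => /eqP.
have L : estimate_nat (t + r) (t + e) (t + 2 * e + Q) (14 + 16 * #|kids a|) xi.
  apply: (@estimate_red (fun u v => 2 * ((u \in limb a) * (v \in [set b])))) => // [u v ua va|].
    have uc : u != c by rewrite -branch_eqc ua branch_eqc.
    have vc : v != c by rewrite -branch_eqc va branch_eqc.
    have := tdistE u a; have := tdistE b v; have := tdistE u v.
    rewrite !limbP // uc in_set1 /overlap uc bc ua va (branch_near an) (branch_far bf) !eqxx.
    rewrite (eq_sym a) (negPf pba) /samefar !inE ?la ?lb (eq_sym b).
    have rb : (v == b) -> lev v = 2 by move/eqP ->.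
    have ra : (u == a) -> lev u = 1 by move/eqP ->.
    have := lev_gt0 uc; have := lev_gt0 vc.
    move: (lev u) (lev v) (tdist u v) (tdist b v) (tdist u a) ra rb => lu lv d db da; clear.
    case: (u == a) => [/(_ isT) ->|_]; case: (v == b) => [/(_ isT) ->|_];
    by case: (u == v); case: (lu =P 2); rewrite ?andbT ?andbF /=; lia.
  transitivity (2 * \sum_u \sum_v wt u * ((u \in limb a) * (v \in [set b]) + (v \in limb a) * (u \in [set b]))).
      rewrite big_distrr; apply: eq_bigr => u _; rewrite big_distrr; apply: eq_bigr => v _ /=.
      by rewrite -mulnDr mulnCA.
    by rewrite product_sum wt_limb // card_limb // big_set1 cards1 /wt lb; lia.
rewrite card_shift; have sq := spare_sqr; rewrite expnS expn1 in sq.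
  have m2 := matching_le2; have [ka|ka] := posnP #|kids a|; last first.
    have m1 : m <= t + 1 by rewrite matching_le1 // supp_kids // ka.
    have t4 : 4 <= t by rewrite -(leq_add2r 1); apply: leq_trans m5 m1.
    exact: bound_lt_square t4 (spare_le an) sq (kids_spare an) m1 L.
  have kpb : 0 < #|kids (par b)| by apply/card_gt0P; exists b; rewrite in_kids bf eqxx.
  have [k1|k1] := eqVneq #|kids (par b)| 1.
    have m1 : m <= t + 1 by apply: matching_le1_single k1 => //; right.
    have t4 : 4 <= t by rewrite -(leq_add2r 1); apply: leq_trans m5 m1.
    exact: bound_lt_square t4 (spare_le an) sq (kids_spare an) m1 L.
  rewrite ka muln0 addn0 in L; apply: bound_lt_square_bare L => //.
    by have := spare_le pbn; rewrite /spare; lia.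
  by have := supp_near1 an; rewrite supp_kids // ka => /(_ isT); lia.
Qed.

(** The cycle is the pentagon [c], [par a], [a], [b], [par b]. Each end gains 1 towards the whole
    branch of the other; these two gains add up for the pair [a], [b], which gains 1 more, its
    distance dropping from 4 to 1. *)
Lemma case_far_diff : 5 <= m -> a \in far -> b \in far -> par a != par b ->
  bound_lt m #|G| xi \/ [/\ bound_le m #|G| xi, s = t & m = t + 1].
Proof.
move=> m5 af bf pab; have t3 : 3 <= t by rewrite -(leq_add2r 2); apply: leq_trans m5 matching_le2.
have [ac bc] := extra_neq; have pan := far_par af; have pbn := far_par bf.
have lb : lev b = 2 by move: bf; rewrite inE => /eqP.
have la : lev a = 2 by move: af; rewrite inE => /eqP.
have ka : 0 < #|kids (par a)| by apply/card_gt0P; exists a; rewrite in_kids af eqxx.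
have kb : 0 < #|kids (par b)| by apply/card_gt0P; exists b; rewrite in_kids bf eqxx.
have L : estimate_nat (t + r) (t + e) (t + 2 * e + Q) (38 + 8 * (spare (par a) + spare (par b))) xi.
  apply: (@estimate_red (fun u v => (u \in [set a]) * (v \in limb (par b)) +
   (u \in limb (par a)) * (v \in [set b]) + (u \in [set a]) * (v \in [set b]))) => // [u v ua va|].
    have uc : u != c by rewrite -branch_eqc ua branch_eqc.
    have vc : v != c by rewrite -branch_eqc va branch_eqc.
    have := tdistE u a; have := tdistE b v; have := tdistE u v.
    rewrite !limbP // uc vc !in_set1 /overlap uc bc ua va (branch_far af) (branch_far bf) !eqxx.
    rewrite (negPf pab) /samefar !inE ?la ?lb (eq_sym b).
    have rb : (v == b) -> lev v = 2 by move/eqP ->.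
    have ra : (u == a) -> lev u = 2 by move/eqP ->.
    have := lev_gt0 uc; have := lev_gt0 vc.
    move: (lev u) (lev v) (tdist u v) (tdist b v) (tdist u a) ra rb => lu lv d db da; clear.
    case: (u == a) => [/(_ isT) ->|_]; case: (v == b) => [/(_ isT) ->|_];
    by case: (u == v); rewrite ?andbT ?andbF /=; lia.
  transitivity (\sum_u \sum_v wt u * ((u \in [set a]) * (v \in limb (par b)) + (v \in [set a]) * (u \in limb (par b))) +
      \sum_u \sum_v wt u * ((u \in limb (par a)) * (v \in [set b]) + (v \in limb (par a)) * (u \in [set b])) +
      \sum_u \sum_v wt u * ((u \in [set a]) * (v \in [set b]) + (v \in [set a]) * (u \in [set b]))).
      rewrite -!big_split; apply: eq_bigr => u _ /=; rewrite -!big_split; apply: eq_bigr => v _ /=.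
      rewrite -!mulnDr; congr (_ * _).
      by rewrite addnACA; congr (_ + _); apply: addnACA.
    rewrite !product_sum !wt_limb // !card_limb // !big_set1 !cards1 /wt la lb /spare.
    by move: #|kids (par a)| #|kids (par b)| ka kb; clear; lia.
rewrite card_shift; have m2 := matching_le2; have ts := supp_le_far.
  have [pe pq] := spare_pair pan pbn pab; rewrite expnS expn1 in pq.
  have [m1|m1] := leqP m (t + 1).
    have t4 : 4 <= t by rewrite -(leq_add2r 1); apply: leq_trans m5 m1.
    case: (bound_lt_pentagon _ _ _ _ _ _ _ _ t4 pe pq m1 L) => [|[le e0 mt]]; first by left.
    by clear -le e0 mt ts; right; split=> //; lia.
  (* Here [m > t + 1], so by [matching_le1_single] neither end is an only child. *)
  have k1 y : y = a \/ y = b -> y \in far -> 0 < #|kids (par y)| -> 1 <= spare (par y).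
    move=> yab yf ky; rewrite /spare; have [k1|] := eqVneq #|kids (par y)| 1.
      by have := matching_le1_single yab yf k1; rewrite leqNgt m1.
    by move: ky; clear; lia.
  left; apply: (bound_lt_pentagon_full _ _ _ _ _ _ _ _ t3 _ _ pe pq m2 L).
    by apply: k1 => //; left.
  by apply: k1 => //; right.
Qed.

(** * Recognizing the two exceptional graphs *)

Lemma adj_near v w : v \in near -> v != a -> v != b -> adj v w = (w == c) || (w \in kids v).
Proof.
move=> vn va vb; apply/idP/orP => [/adjP[[_ ->]|[wc vw]|[va' _]|[vb' _]]|[/eqP->|]].
- by left; rewrite near_par.
- right; rewrite in_kids vw eqxx andbT; case: (vertex_cases w) => // [wc'|wn].
    by rewrite wc' eqxx in wc.
  by move: (near_neq vn); rewrite vw near_par // eqxx.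
- by rewrite va' eqxx in va.
- by rewrite vb' eqxx in vb.
- by rewrite -(near_par vn) par_adj1 // near_neq.
- by rewrite in_kids => /andP[wf /eqP <-]; rewrite adj_sym par_adj1 // far_neq.
Qed.

Lemma near_far x y : x \in near -> y \in far -> x != y.
Proof. by rewrite !inE => /eqP lx /eqP ly; apply: contra_eq_neq lx => ->; rewrite ly. Qed.

Lemma adj_far y w : y \in far -> y != a -> y != b -> adj y w = (w == par y).
Proof.
move=> yf ya yb; apply/idP/eqP => [/adjP[[_ ->]|[wc yw]|[ya' _]|[yb' _]]|->] //.
- case: (vertex_cases w) => [wc'|wn|wf]; first by rewrite wc' eqxx in wc.
    by have := far_neq yf; rewrite yw near_par // eqxx.
  by have := near_far (far_par wf) yf; rewrite yw eqxx.
- by rewrite ya' eqxx in ya.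
- by rewrite yb' eqxx in yb.
- by rewrite par_adj1 // far_neq.
Qed.

Definition child y := odflt y [pick z in kids y].

Lemma child_far y : y \in supp -> child y \in far /\ par (child y) = y.
Proof.
rewrite inE => /andP[_ /card_gt0P[z zk]]; rewrite /child.
case: pickP => [w|/(_ z)]; last by rewrite zk.
by rewrite in_kids => /andP[wf /eqP].
Qed.

(** [s = t] leaves no spare child, so each vertex of [supp] has exactly one child. *)
Lemma kids_child y : s = t -> y \in supp -> kids y = [set child y].
Proof.
move=> st ys; have yn : y \in near by move: ys; rewrite inE => /andP[].
have := spare_le yn; rewrite st subnn /spare => k1.
have : 0 < #|kids y| by rewrite -supp_kids.
have [cf cy] := child_far ys; move=> k0.
have /cards1P[z kz] : #|kids y| == 1 by clear -k0 k1; lia.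
have : child y \in kids y by rewrite in_kids cf cy eqxx.
by rewrite kz inE => /eqP ->.
Qed.

Lemma adj_supp v w : s = t -> v \in supp -> v != a -> v != b ->
  adj v w = (w == c) || (w == child v).
Proof.
move=> st vs va vb; have vn : v \in near by move: vs; rewrite inE => /andP[].
by rewrite adj_near // kids_child // in_set1.
Qed.

Lemma child_inj : {in supp &, injective child}.
Proof. by move=> x y /child_far[_ ex] /child_far[_ ey] E; rewrite -ex E ey. Qed.

(** The vertices of [supp] with their children are the pendant paths, and the childless vertices at
    depth 1 other than [a] and [b] are the pendant vertices. *)
Lemma triangle_iso : a \in near -> b \in near -> #|kids a| = 0 -> #|kids b| = 0 ->
  s = t -> m = t + 2 -> 2 * m <= #|G| -> isomorphic G (U_graph #|G| m).
Proof.
move=> an bn ka kb st mt m2; rewrite /U_graph.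
have as_ : a \notin supp by rewrite supp_kids // ka.
have bs_ : b \notin supp by rewrite supp_kids // kb.
have anb : a != b by apply: contraTneq ab => ->; rewrite adj_irrefl.
have [ac bc] := extra_neq.
pose S := a |: (b |: supp); pose P := near :\: S.
have SN : S \subset near.
  by rewrite !subUset !sub1set an bn; apply/subsetP => x; rewrite inE => /andP[].
have cS : #|S| = t + 2 by rewrite !cardsU1 bs_ in_setU1 negb_or anb as_ addn2.
have cP : #|P| + (t + 2) = k by rewrite -cS addnC -(cardsID S near) (setIidPr SN).
have cG : #|G| = 1 + k + t by rewrite card_levels st.
(* [2 * m <= #|G|] keeps the subtraction from being truncated. *)
have -> : #|G| - 2 * m + 1 = #|P| by lia.
have -> : m - 2 = #|supp| by lia.
pose f (i : cycle_graph 3) := nth c [:: c; a; b] i.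
have fE : forall i, f i = c \/ f i = a \/ f i = b by case=> [[|[|[|]]]] //= i; rewrite /f /=; auto.
apply: (attach_iso (f := f) (ch := child)).
- case=> [[|[|[|]]] //= i3] [[|[|[|]]] //= j3]; rewrite /f /= => E; apply/val_inj => //=;
  by [move: ac bc anb; rewrite E ?eqxx|move: ac bc anb; rewrite -E ?eqxx].
- have ca : adj c a by rewrite adj_sym -(near_par an) par_adj1.
  have cb : adj c b by rewrite adj_sym -(near_par bn) par_adj1.
  case=> [[|[|[|]]] //= i3] [[|[|[|]]] //= j3]; rewrite /f /= /cycle_adj /= ?adj_irrefl //;
  by rewrite ?ab ?ca ?cb // adj_sym ?ab ?ca ?cb.
- by move=> x; rewrite !inE; case: (fE x) => [->|[->|->]]; rewrite ?levc ?eqxx ?orbT ?andbF.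
- by move=> x; case: (fE x) => [->|[->|->]] //; rewrite !inE levc.
- by apply/pred0P => x /=; rewrite !inE; case: (_ && (0 < _)); rewrite ?orbT ?andbF.
- exact: child_inj.
- move=> y x ys; have [cf _] := child_far ys.
  by case: (fE x) => [->|[->|->]]; rewrite ?far_neq // eq_sym near_far.
- move=> y ys; have [cf _] := child_far ys; apply/negP; rewrite in_setD => /andP[_ cn].
  by have := near_far cn cf; rewrite eqxx.
- move=> y ys; have [cf _] := child_far ys; apply/negP; rewrite inE => /andP[cn _].
  by have := near_far cn cf; rewrite eqxx.
- by rewrite card_ord cG; lia.
- move=> v w; rewrite in_setD !in_setU1 !negb_or => /andP[/and3P[va vb vs] vn].
  rewrite adj_near // [f _]/=.
  have -> : w \in kids v = false; last by rewrite orbF.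
  by move: vs; rewrite supp_kids // -eqn0Ngt cards_eq0 => /eqP ->; rewrite inE.
- move=> v w vs; rewrite adj_supp //; first by apply: contraNneq as_ => <-.
  by apply: contraNneq bs_ => <-.
- move=> v w vs; have [cf cp] := child_far vs; rewrite adj_far ?cp // eq_sym near_far //.
Qed.

(** The branches of [par a] and [par b] are absorbed by the cycle, so the pendant paths come from
    the rest of [supp]. *)
Lemma pentagon_iso : a \in far -> b \in far -> par a != par b ->
  s = t -> m = t + 1 -> 2 * m <= #|G| -> isomorphic G (U'_graph #|G| m).
Proof.
move=> af bf pab st mt m2; rewrite /U'_graph.
have pas := supp_par af; have pbs := supp_par bf.
have pan := far_par af; have pbn := far_par bf.
have anb : a != b by apply: contraTneq ab => ->; rewrite adj_irrefl.
have SN : supp \subset near by apply/subsetP => x; rewrite inE => /andP[].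
pose P := near :\: supp; pose Q := supp :\: [set par a; par b].
have cP : #|P| + t = k by rewrite addnC -(cardsID supp near) (setIidPr SN).
have cQ : #|Q| + 2 = t.
  have <- : #|[set par a; par b]| = 2 by rewrite cards2 pab.
  rewrite addnC -(cardsID [set par a; par b] supp) (setIidPr _) //.
  by rewrite subUset !sub1set pas pbs.
have cG : #|G| = 1 + k + t by rewrite card_levels st.
have -> : #|G| - 2 * m + 1 = #|P| by clear -cP cG mt m2; lia.
have -> : m - 3 = #|Q| by clear -cQ mt; lia.
have QP y : y \in Q -> [/\ y \in supp, y != par a & y != par b].
  by rewrite in_setD !inE negb_or -andbA => /and4P[-> -> -> ->].
have ca y : y \in Q -> child y != a.
  by case/QP=> /child_far[_ cy] ya _; apply: contraNneq ya => <-; rewrite cy.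
have cb y : y \in Q -> child y != b.
  by case/QP=> /child_far[_ cy] _ yb; apply: contraNneq yb => <-; rewrite cy.
pose l := [:: c; par a; a; b; par b].
have ul : uniq l.
  rewrite /l /= !inE !negb_or anb pab eq_sym (near_neq pan) eq_sym (far_neq af).
  rewrite eq_sym (far_neq bf) eq_sym (near_neq pbn) (near_far pan af) (near_far pan bf).
  by rewrite !(eq_sym _ (par b)) (near_far pbn af) (near_far pbn bf).
pose f (i : cycle_graph 5) := nth c l i.
have fE (i : cycle_graph 5) : [\/ f i = c, f i = par a \/ f i = par b | f i = a \/ f i = b].
  by case: i => [[|[|[|[|[|]]]]] //= i5]; rewrite /f /=;
    [constructor 1|constructor 2; left|constructor 3; left|constructor 3; right|constructor 2; right].
have cn : c \notin near by apply/negP => /near_neq; rewrite eqxx.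
have farn y : y \in far -> y \notin near.
  by move=> yf; apply/negP => yn; have := near_far yn yf; rewrite eqxx.
have pa_a := near_far pan af; have pa_b := near_far pan bf.
have pb_a := near_far pbn af; have pb_b := near_far pbn bf.
apply: (attach_iso (f := f) (ch := child)).
- move=> i j E; apply/val_inj; have := @nth_uniq _ c l i j (ltn_ord i) (ltn_ord j) ul.
  by rewrite -/(f i) -/(f j) E eqxx => /esym/eqP.
- have e1 : adj c (par a) by rewrite adj_sym -(near_par pan) par_adj1 // near_neq.
  have e2 : adj c (par b) by rewrite adj_sym -(near_par pbn) par_adj1 // near_neq.
  have e3 : adj (par a) a by rewrite adj_sym par_adj1 // far_neq.
  have e4 : adj (par b) b by rewrite adj_sym par_adj1 // far_neq.
  have n1 y : y \in far -> adj c y = false.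
    rewrite inE adj_sym => /eqP ly; apply/negP => /lev_adj; by rewrite ly levc.
  have n2 : adj (par a) (par b) = false.
    by rewrite adj_near // (negPf (near_neq pbn)) in_kids (negPf (contra (@farn _) _)) // pbn.
  have n3 : adj (par a) b = false.
    by rewrite adj_near // (negPf (far_neq bf)) in_kids eq_sym (negPf pab) andbF.
  have n4 : adj (par b) a = false.
    by rewrite adj_near // (negPf (far_neq af)) in_kids (negPf pab) andbF.
  have tbl := (ab, e1, e2, e3, e4, n1 a af, n1 b bf, n2, n3, n4, adj_irrefl).
  case=> [[|[|[|[|[|]]]]] //= i5] [[|[|[|[|[|]]]]] //= j5]; rewrite /f /= /cycle_adj /= ?tbl //;
  by rewrite // adj_sym ?tbl.
- move=> x; rewrite in_setD; case: (fE x) => [->|[]->|[]->]; rewrite ?pas ?pbs ?(negPf cn) ?andbF //.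
    by rewrite (negPf (farn _ af)) andbF.
  by rewrite (negPf (farn _ bf)) andbF.
- move=> x; apply/negP => /QP[]; case: (fE x) => [->|[]->|[]->]; rewrite ?eqxx //.
  + by rewrite inE (negPf cn).
  + by rewrite inE (negPf (farn _ af)).
  + by rewrite inE (negPf (farn _ bf)).
- apply/pred0P => x /=; apply/negP => /andP[]; rewrite in_setD => /andP[xs _] /QP[].
  by rewrite (negPf xs).
- by move=> x y /QP[xs _ _] /QP[ys _ _]; apply: child_inj.
- move=> y x /[dup] yQ /QP[/child_far[cf _] _ _].
  case: (fE x) => [->|[]->|[]->]; rewrite ?ca ?cb ?far_neq // eq_sym near_far //.
- by move=> y /QP[/child_far[cf _] _ _]; rewrite in_setD (negPf (farn _ cf)) andbF.
- move=> y /QP[/child_far[cf _] _ _]; apply/negP => /QP[+ _ _].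
  by rewrite inE (negPf (farn _ cf)).
- by rewrite card_ord cG; clear -cP cQ; lia.
- move=> v w; rewrite in_setD => /andP[vs vn].
  have va : v != a by apply: near_far vn af.
  have vb : v != b by apply: near_far vn bf.
  rewrite adj_near // [f _]/=.
  have -> : w \in kids v = false; last by rewrite orbF.
  by move: vs; rewrite supp_kids // -eqn0Ngt cards_eq0 => /eqP ->; rewrite inE.
- move=> v w /QP[vs _ _]; have vn := subsetP SN v vs; rewrite adj_supp //; exact: near_far.
- move=> v w vQ; have [vs _ _] := QP v vQ; have [cf cp] := child_far vs.
  by rewrite adj_far ?ca ?cb // cp.
Qed.

End TwoLevels.

(** * The eccentric distance sum of U' *)

Section PentagonUpperBound.
Variables (G : sgraph) (p q : nat).
Let A := attach (ord0 : cycle_graph 5) p q.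
Variable g : A -> G.
Hypotheses (conn : connected G) (g_bij : bijective g).
Hypothesis g_adj : forall x y, adj (g x) (g y) = adj x y.

(* Distance to the attaching vertex, and the amount by which [depth x + depth y] exceeds
   the distance from x to y. *)
Definition depth (x : A) : nat :=
  match x with
  | inl i => cycdist 5 i 0
  | inr (inl _) => 1
  | inr (inr (_, far)) => 1 + far
  end.

Definition saving (x y : A) : nat :=
  match x, y with
  | inl i, inl j => cycdist 5 i 0 + cycdist 5 j 0 - cycdist 5 i j
  | inr (inl i), inr (inl j) => 2 * (i == j)
  | inr (inr (i, s)), inr (inr (j, t)) => (i == j) * (2 + 2 * (s && t))
  | _, _ => 0
  end.

Lemma dist_g x y : adj x y -> dist (g x) (g y) <= 1.
Proof. by rewrite -g_adj; apply: dist_adj. Qed.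

Lemma dist_g2 z x y : adj x z -> adj z y -> dist (g x) (g y) <= 2.
Proof.
move=> xz zy; apply: leq_trans (dist_triangle conn _ (g z) _) _.
by rewrite (leq_add (dist_g xz) (dist_g zy)).
Qed.

Lemma pentagon_dist_le (i j : 'I_5) : dist (g (inl i)) (g (inl j)) <= cycdist 5 i j.
Proof.
case: i j => [[|[|[|[|[|]]]]] //= i5] [[|[|[|[|[|]]]]] //= j5];
first [ by rewrite (bool_irrelevance i5 j5) distxx
      | by apply: dist_g
      | by apply: (dist_g2 (z := inl (ordS (Ordinal i5))))
      | by apply: (dist_g2 (z := inl (ordS (Ordinal j5)))) ].
Qed.

Lemma dist_root x : dist (g x) (g (inl ord0)) <= depth x.
Proof.
case: x => [i|[i|[j [|]]]] /=; first exact: pentagon_dist_le.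
- by apply: dist_g; rewrite /= ?eqxx.
- by apply: (dist_g2 (z := inr (inr (j, false)))); rewrite /= ?eqxx.
- by apply: dist_g; rewrite /= ?eqxx.
Qed.

Lemma depth_le2 x : depth x <= 2.
Proof. by case: x => [[[|[|[|[|[|]]]]] //= i5]|[i|[j [|]]]]. Qed.

Lemma dist_le_saving x y : dist (g x) (g y) + saving x y <= depth x + depth y.
Proof.
have tri : dist (g x) (g y) <= depth x + depth y.
  apply: leq_trans (dist_triangle conn _ (g (inl ord0)) _) (leq_add (dist_root x) _).
  by rewrite (dist_sym conn) dist_root.
case: x y tri => [i|[i|[i s]]] [j|[j|[j t]]] tri; rewrite /saving ?addn0 //.
- have := pentagon_dist_le i j; have : cycdist 5 i j <= cycdist 5 i 0 + cycdist 5 j 0.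
    by clear; have := ltn_ord i; have := ltn_ord j; rewrite /cycdist; lia.
  by rewrite /=; move: (dist _ _) (cycdist 5 _ _) (cycdist 5 _ _) (cycdist 5 _ _) => d d1 d2 d3; clear; lia.
- by case: eqP tri => [->|]; rewrite ?distxx ?addn0.
- case: (eqVneq i j) tri => [<-|]; rewrite ?addn0 // mul1n => tri.
  case: s t tri => [] [] tri /=; rewrite ?distxx //.
    by rewrite -(leq_add2r 2) in tri *; apply: leq_add (dist_g _) _; rewrite /= ?eqxx.
  by apply: (@leq_add _ _ 1 2) => //; apply: dist_g; rewrite /= ?eqxx.
Qed.

Lemma ecc_le_depth x : ecc (g x) <= 2 + depth x.
Proof.
rewrite /ecc; apply/bigmax_leqP => v _; have [g' gK g'K] := g_bij.
rewrite -(g'K v); apply: leq_trans (_ : depth (g' v) + depth x <= _); last first.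
  by rewrite leq_add2r depth_le2.
by apply: leq_trans (dist_le_saving (g' v) x); apply: leq_addr.
Qed.

Lemma big_attach (F : A -> nat) :
  \sum_x F x = \sum_(i < 5) F (inl i) + (\sum_(i < p) F (inr (inl i)) +
    \sum_(i < q) (F (inr (inr (i, true))) + F (inr (inr (i, false))))).
Proof.
rewrite big_sumType /= big_sumType /=; congr (_ + (_ + _)).
transitivity (\sum_(i < q) \sum_(b : bool) F (inr (inr (i, b)))).
  by rewrite pair_bigA; apply: eq_bigr => -[].
by apply: eq_bigr => i _; rewrite big_bool.
Qed.

Lemma sum_depth (f : nat -> nat) :
  \sum_x f (depth x) = f 0 + 2 * f 1 + 2 * f 2 + p * f 1 + q * (f 1 + f 2).
Proof.
rewrite big_attach /= !sum_nat_const !card_ord !big_ord_recl big_ord0 /= /cycdist /= /bump /=.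
by move: (f 0) (f 1) (f 2) => f0 f1 f2; clear; lia.
Qed.

Lemma saving_row x : \sum_y saving x y =
  match x with
  | inl i => \sum_(j < 5) (cycdist 5 i 0 + cycdist 5 j 0 - cycdist 5 i j)
  | inr (inl _) => 2
  | inr (inr (_, far)) => 4 + 2 * far
  end.
Proof.
have d1 n (i : 'I_n) (k : nat) : \sum_(j < n) (i == j) * k = k.
  rewrite (bigD1 i) //= eqxx mul1n big1 ?addn0 // => j ji.
  by rewrite eq_sym (negPf ji).
rewrite big_attach; case: x => [i|[i|[i s]]] /=.
- by rewrite !sum_nat_const !muln0 !addn0.
- by rewrite !sum_nat_const !muln0 addn0 add0n (eq_bigr (fun j => (i == j) * 2)) ?d1 // => j _; rewrite mulnC.
- rewrite !sum_nat_const !muln0 !add0n (eq_bigr (fun j => (i == j) * (4 + 2 * s))) ?d1 // => j _.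
  by rewrite -mulnDr andbT andbF; case: s.
Qed.

(** Here [n = 5 + p + 2 * q] and [m = q + 3]. Distances are at most the sum of the depths minus
    [saving], and eccentricities at most [2 + depth], because no depth exceeds 2. *)
Lemma eds_pentagon_le : ecc_dist_sum G + 28 * (q + 3) + 22 * (5 + p + 2 * q) + 4 <=
  6 * (5 + p + 2 * q) ^ 2 + (q + 3) ^ 2 + 9 * (q + 3) * (5 + p + 2 * q).
Proof.
have cA : #|A| = 5 + p + 2 * q by rewrite !card_sum card_prod !card_ord card_bool; lia.
have E : ecc_dist_sum G + \sum_(x : A) (2 + depth x) * \sum_y saving x y <=
    \sum_(x : A) (2 + depth x) * \sum_(y : A) (depth x + depth y).
  rewrite /ecc_dist_sum (reindex g) /=; last exact: onW_bij.
  rewrite -big_split; apply: leq_sum => x _ /=.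
  apply: (@leq_trans ((2 + depth x) * dist_sum (g x) + (2 + depth x) * \sum_y saving x y)).
    by rewrite leq_add2r leq_mul2r ecc_le_depth orbT.
  rewrite -mulnDr leq_mul2l /dist_sum (reindex g) /=; last exact: onW_bij.
  rewrite -big_split; apply: leq_sum => y _ /=.
  by rewrite (dist_sym conn) dist_le_saving.
have E1 : \sum_(x : A) (2 + depth x) * \sum_(y : A) (depth x + depth y) =
  \sum_(x : A) ((2 + depth x) * (#|A| * depth x + \sum_(y : A) depth y)).
  by apply: eq_bigr => x _; rewrite big_split /= sum_nat_const.
rewrite E1 (sum_depth id) (sum_depth (fun h => (2 + h) * (#|A| * h + _))) cA in E.
(* The cycle contributes 110, a pendant vertex [3 * 2], and a pendant path [3 * 4 + 4 * 6]. *)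
have E2 : \sum_(x : A) (2 + depth x) * \sum_y saving x y = 110 + 6 * p + 36 * q.
  under eq_bigr => x _ do rewrite saving_row.
  rewrite big_attach /= !sum_nat_const !card_ord.
  have -> : \sum_(i < 5) (2 + cycdist 5 i 0) *
      \sum_(j < 5) (cycdist 5 i 0 + cycdist 5 j 0 - cycdist 5 i j) = 110.
    by rewrite !big_ord_recl !big_ord0.
  by clear; lia.
by rewrite E2 in E; move: E; rewrite !expnS !expn0 !muln1; clear; lia.
Qed.

End PentagonUpperBound.

(** * Assembling the cases *)

Lemma eds_of_ecc_le2 (G : sgraph) (c : G) :
  unicyclic G -> 5 <= matching_number G -> (forall x, dist x c <= 2) ->
  [\/ bound_lt (matching_number G) #|G| (ecc_dist_sum G),
      isomorphic G (U_graph #|G| (matching_number G)) |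
      bound_le (matching_number G) #|G| (ecc_dist_sum G) /\
      isomorphic G (U'_graph #|G| (matching_number G))].
Proof.
move=> Guni m5 ecc2; have [conn _] := Guni.
have [par parP] := parent_to1 c conn.
have [a [b [ab nab nba adjP]]] := extra_edge Guni parP.
have [ac bc] := extra_neq Guni parP ab nab nba.
have m2 := matching_half G.
have ba : adj b a by rewrite adj_sym.
(* The ends of the extra edge are interchangeable; the swapped form serves for [a] at depth 2 and
   [b] at depth 1. *)
have adjP' : forall x y, adj x y -> [\/ x != c /\ y = par x, y != c /\ x = par y,
    x = b /\ y = a | x = a /\ y = b].
  by move=> x y /adjP[]; [constructor 1|constructor 2|constructor 4|constructor 3].
case: (vertex_cases Guni ecc2 a) => [E|an|af]; first by rewrite E eqxx in ac.
  case: (vertex_cases Guni ecc2 b) => [E|bn|bf]; first by rewrite E eqxx in bc.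
    have [lt|[ka kb st mt]] := case_near_near Guni parP ecc2 ab nab nba adjP m5 an bn.
      by constructor 1.
    by constructor 2; apply: (triangle_iso Guni parP ecc2 ab nab nba adjP).
  by constructor 1; apply: (case_near_far Guni parP ecc2 ab nab nba adjP).
case: (vertex_cases Guni ecc2 b) => [E|bn|bf]; first by rewrite E eqxx in bc.
  by constructor 1; apply: (case_near_far Guni parP ecc2 ba nba nab adjP').
have [pab|pab] := eqVneq (par a) (par b).
  by constructor 1; apply: (case_far_same Guni parP ecc2 ab nab nba adjP).
have [lt|[le st mt]] := case_far_diff Guni parP ecc2 ab nab nba adjP m5 af bf pab.
  by constructor 1.
by constructor 3; split=> //; apply: (pentagon_iso Guni parP ecc2 ab adjP).
Qed.

Lemma eds_le_pentagon (G : sgraph) m : connected G -> 3 <= m -> 2 * m <= #|G| ->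
  isomorphic G (U'_graph #|G| m) ->
  ecc_dist_sum G + 28 * m + 22 * #|G| + 4 <= 6 * #|G| ^ 2 + m ^ 2 + 9 * m * #|G|.
Proof.
move=> conn m3 m2 /isomorphic_sym[g g_bij g_adj].
have := eds_pentagon_le conn g_bij g_adj.
have -> : m - 3 + 3 = m by lia.
by have -> : 5 + (#|G| - 2 * m + 1) + 2 * (m - 3) = #|G| by lia.
Qed.

Lemma eds_trichotomy (G : sgraph) : unicyclic G -> 5 <= matching_number G ->
  [\/ bound_lt (matching_number G) #|G| (ecc_dist_sum G),
      isomorphic G (U_graph #|G| (matching_number G)) |
      bound_le (matching_number G) #|G| (ecc_dist_sum G) /\
      isomorphic G (U'_graph #|G| (matching_number G))].
Proof.
move=> Guni m5; have [conn _] := Guni.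
have [/existsP[c /forallP c2]|] := boolP [exists c : G, forall x : G, dist x c <= 2].
  exact: eds_of_ecc_le2 c2.
rewrite negb_exists => /forallP far3.
have ecc3 (x : G) : 3 <= ecc x.
  have := far3 x; rewrite negb_forall => /existsP[y]; rewrite -ltnNge => d.
  exact: leq_trans d (ecc_le x y).
have [v _] : exists v : G, true.
  have : 0 < #|G| by apply: leq_trans (matching_half G); lia.
  by case/card_gt0P=> v _; exists v.
have [s [s_uniq s_cycle s_size]] := unicyclic_cycle Guni v.
have [c0 c0s] : exists c0, c0 \in [set x in s].
  by case: s s_size {s_uniq s_cycle} => // c0 s _; exists c0; rewrite inE mem_head.
have [lev [par parP]] := parent_to_set conn c0s.
constructor 1; have := eds_gt_of_ecc_ge3 Guni s_uniq s_cycle s_size parP (erefl _) m5 ecc3.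
by rewrite /bound_lt !expnS !expn0 !muln1 mulnA.
Qed.

Local Open Scope ring_scope.

Theorem theorem3p7 (n m : nat) (G : sgraph)
    (m_ge5 : (5 <= m)%N)
    (GU : unicyclic_nm n m G)
    (G_neq : ~ isomorphic G (U_graph n m)) :
  let bound : int :=
    6 * n%:Z ^+ 2 + m%:Z ^+ 2 + 9 * m%:Z * n%:Z - 28 * m%:Z - 22 * n%:Z - 4 in
  bound <= (ecc_dist_sum G)%:Z
  /\ ((ecc_dist_sum G)%:Z = bound <-> isomorphic G (U'_graph n m)).
Proof.
case: GU => Guni nE mE; have conn := proj1 Guni; move=> bound.
have boundE : bound + 28 * m%:Z + 22 * n%:Z + 4 = (6 * n * n + m * m + 9 * m * n)%N%:Z.
  by rewrite /bound; lia.
clearbody bound; subst n m.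
(* This reverse inequality excludes [U'_{n,m}] when the bound is strict, and turns the weak bound
   into the equality for [U'_{n,m}]. *)
have upper := eds_le_pentagon conn (leq_trans (isT : 3 <= 5)%N m_ge5) (matching_half G).
rewrite !expnS !expn0 !muln1 mulnA in upper.
case: (eds_trichotomy Guni m_ge5) => [lt|/G_neq//|[le iso]].
  split; first by move: lt; rewrite /bound_lt; lia.
  split=> [eq|/upper]; first by move: lt; rewrite /bound_lt; lia.
  by move: lt; rewrite /bound_lt; lia.
have {}upper := upper iso; split; first by move: le; rewrite /bound_le; lia.
by split=> // _; move: le upper; rewrite /bound_le; lia.
Qed.
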